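(* Let $(R,\mathfrak m)$ be a $d$-dimensional local OK domain of prime characteristic $p>0$, and let $I_\bullet$ and $J_\bullet$ be $p$-families of $\mathfrak m$-primary ideals of $R$. Let $L_\bullet$ be the $p$-family with $L_q=I_qJ_q$. Then the volumes $\operatorname{vol}_R(I_\bullet),\operatorname{vol}_R(J_\bullet),\operatorname{vol}_R(L_\bullet)$ exist and \[\operatorname{vol}_R(I_\bullet)^{1/d}+\operatorname{vol}_R(J_\bullet)^{1/d}\ge\operatorname{vol}_R(L_\bullet)^{1/d}.\]
   Context: $p$ prime; $q$ denotes powers $p^e$, $e\ge0$, and $q\to\infty$ means $e\to\infty$. A $p$-family of ideals in a ring of characteristic $p$ is a sequence $\{I_q\}$ of ideals indexed by the powers $q$ of $p$ with $I_q^{[p]}\subseteq I_{pq}$ (where $I^{[p]}$ is generated by $p$-th powers of elements of $I$). For a $p$-family $I_\bullet$ of $\mathfrak m$-primary ideals of a $d$-dimensional local ring $(R,\mathfrak m)$, $\operatorname{vol}_R(I_\bullet)=\lim_{q\to\infty}\ell_R(R/I_q)/q^d$. OK domain: fix $\mathbf a\in\mathbb R^d$ with $\mathbb Q$-linearly independent coordinates and order $\mathbb Z^d$ by $\mathbf u\le\mathbf v$ iff $\langle\mathbf u,\mathbf a\rangle\le\langle\mathbf v,\mathbf a\rangle$. A valuation $\nu:\mathbb F^\times\to\mathbb Z^d$ (surjective homomorphism with $\nu(x+y)\ge\min\{\nu(x),\nu(y)\}$ when $x,y,x+y\ne0$) on the fraction field $\mathbb F$ of a $d$-dimensional local domain $(D,\mathfrak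 m,\Bbbk)$, with $\mathbb F_{\ge\mathbf u}=\{0\}\cup\{x:\nu(x)\ge\mathbf u\}$, valuation ring $V=\mathbb F_{\ge\mathbf0}$, maximal ideal $\mathfrak m_V$, residue field $\Bbbk_V$, is OK relative to $D$ if (i) $D\subseteq V$ and $\mathfrak m=\mathfrak m_V\cap D$; (ii) the closed convex cone generated by $\nu(D\setminus0)$ contains no nonzero $\mathbf u$ with $\langle\mathbf u,\mathbf a\rangle\le0$; (iii) $[\Bbbk_V:\Bbbk]<\infty$; (iv) there is $\mathbf v\in\mathbb Z^d$ with $D\cap\mathbb F_{\ge n\mathbf v}\subseteq\mathfrak m^n$ for all $n\ge0$. $D$ is an OK domain if such a valuation exists (for some $\mathbf a$). Excellent local domains of characteristic $p$ are OK. *)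

(* Defs.v *)
From Stdlib Require Import Reals QArith Qreals ZArith ClassicalEpsilon.
From HB Require Import structures.
From mathcomp Require Import all_boot all_order all_algebra.
From mathcomp Require Import fraction.
Set Implicit Arguments. Unset Strict Implicit. Unset Printing Implicit Defensive.
Import GRing.Theory.
Local Open Scope ring_scope.

Section CommAlg.
Variable A : comNzRingType.

Definition is_ideal (I : A -> Prop) : Prop :=
  I 0 /\ (forall x y, I x -> I y -> I (x + y)) /\ (forall r x, I x -> I (r * x)).

Definition isubset (I J : A -> Prop) : Prop := forall x, I x -> J x.
Definition strict_subset (I J : A -> Prop) : Prop :=
  isubset I J /\ exists x, J x /\ ~ I x.

Definition gen_ideal (S : A -> Prop) : A -> Prop :=
  fun x => forall J, is_ideal J -> isubset S J -> J x.

Definition frob_pow (p : nat) (I : A -> Prop) : A -> Prop :=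
  gen_ideal (fun y => exists x, I x /\ y = x ^+ p).

Definition prod_ideal (I J : A -> Prop) : A -> Prop :=
  gen_ideal (fun y => exists a b, I a /\ J b /\ y = a * b).

Fixpoint ideal_pow (I : A -> Prop) (n : nat) : A -> Prop :=
  match n with
  | O => fun _ => True
  | S n' => prod_ideal (ideal_pow I n') I
  end.

Definition is_prime_ideal (P : A -> Prop) : Prop :=
  is_ideal P /\ ~ P 1 /\ (forall x y, P (x * y) -> P x \/ P y).

Definition is_maximal_ideal (M : A -> Prop) : Prop :=
  is_ideal M /\ ~ M 1 /\
  (forall J, is_ideal J -> isubset M J -> J 1 \/ isubset J M).

Definition noetherian : Prop :=
  forall I, is_ideal I ->
    exists s : seq A, forall x, I x <-> gen_ideal (fun y => y \in s) x.

Definition local_with (m : A -> Prop) : Prop :=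
  is_maximal_ideal m /\
  (forall M, is_maximal_ideal M -> forall x, M x <-> m x).

Definition prime_chain (P : nat -> A -> Prop) (n : nat) : Prop :=
  (forall i, (i <= n)%N -> is_prime_ideal (P i)) /\
  (forall i, (i < n)%N -> strict_subset (P i) (P i.+1)).

Definition krull_dim (d : nat) : Prop :=
  (exists P, prime_chain P d) /\ (forall P n, prime_chain P n -> (n <= d)%N).

Definition m_primary (m I : A -> Prop) : Prop :=
  is_ideal I /\ (forall x, m x <-> exists n, I (x ^+ n)).

(* strict chains of ideals I = K 0 < K 1 < ... < K n = A, i.e. chains of
   submodules of the A-module A/I *)
Definition ideal_chain (I : A -> Prop) (K : nat -> A -> Prop) (n : nat) : Prop :=
  (forall x, K 0%N x <-> I x) /\ (forall x, K n x) /\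
  (forall i, (i <= n)%N -> is_ideal (K i)) /\
  (forall i, (i < n)%N -> strict_subset (K i) (K i.+1)).

Definition is_colength (I : A -> Prop) (n : nat) : Prop :=
  (exists K, ideal_chain I K n) /\ (forall K k, ideal_chain I K k -> (k <= n)%N).

(* ell_A(A/I)  (0 if infinite; never used in that case) *)
Definition colength (I : A -> Prop) : nat :=
  match excluded_middle_informative (exists n, is_colength I n) with
  | left h => proj1_sig (constructive_indefinite_description _ h)
  | right _ => 0%N
  end.

(* p-family of ideals, indexed by the exponent e of q = p^e *)
Definition p_family (p : nat) (I : nat -> A -> Prop) : Prop :=
  (forall e, is_ideal (I e)) /\ (forall e, isubset (frob_pow p (I e)) (I e.+1)).

End CommAlg.

Definition vol_seq (A : comNzRingType) (p d : nat) (I : nat -> A -> Prop) : nat -> R :=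
  fun e => Rdiv (INR (colength (I e))) (pow (INR (expn p e)) d).

Definition rroot (d : nat) (x : R) : R :=
  if Rle_dec x R0 then R0 else Rpower x (Rinv (INR d)).

Definition zvec (d : nat) := 'I_d -> Z.

Definition zdot (d : nat) (u : zvec d) (a : 'I_d -> R) : R :=
  \big[Rplus/R0]_(i < d) Rmult (IZR (u i)) (a i).
Definition rdot (d : nat) (u : 'I_d -> R) (a : 'I_d -> R) : R :=
  \big[Rplus/R0]_(i < d) Rmult (u i) (a i).

Definition zle (d : nat) (a : 'I_d -> R) (u v : zvec d) : Prop := Rle (zdot u a) (zdot v a).
Definition zlt (d : nat) (a : 'I_d -> R) (u v : zvec d) : Prop := Rlt (zdot u a) (zdot v a).

Definition zadd (d : nat) (u v : zvec d) : zvec d := fun i => Z.add (u i) (v i).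
Definition zscale (d : nat) (n : nat) (v : zvec d) : zvec d := fun i => Z.mul (Z.of_nat n) (v i).
Definition zzero (d : nat) : zvec d := fun _ => Z0.

Definition Q_lin_indep (d : nat) (a : 'I_d -> R) : Prop :=
  forall c : 'I_d -> Q,
    \big[Rplus/R0]_(i < d) Rmult (Q2R (c i)) (a i) = R0 -> forall i, Qeq (c i) (inject_Z Z0).

Section Valuation.
Variables (D : idomainType) (d : nat) (a : 'I_d -> R) (nu : {fraction D} -> zvec d).
Local Notation F := {fraction D}.
Local Notation "x %:F" := (@FracField.tofrac D x).

(* nu is a valuation F^x -> Z^d (values at 0 irrelevant) *)
Definition is_valuation : Prop :=
  (forall x y : F, x != 0 -> y != 0 -> forall i, nu (x * y) i = zadd (nu x) (nu y) i) /\
  (forall u : zvec d, exists x : F, x != 0 /\ forall i, nu x i = u i) /\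
  (forall x y : F, x != 0 -> y != 0 -> x + y != 0 ->
      zle a (nu x) (nu (x + y)) \/ zle a (nu y) (nu (x + y))).

Definition F_ge (u : zvec d) (x : F) : Prop := x = 0 \/ (x != 0 /\ zle a u (nu x)).
Definition val_ring (x : F) : Prop := F_ge (@zzero d) x.
Definition val_max (x : F) : Prop := x = 0 \/ (x != 0 /\ zlt a (@zzero d) (nu x)).

Definition in_cone (w : 'I_d -> R) : Prop :=
  exists l : seq (R * D),
    (forall pr, List.In pr l -> Rle R0 pr.1 /\ pr.2 != 0) /\
    (forall i, w i = List.fold_right
        (fun pr acc => Rplus (Rmult pr.1 (IZR (nu (pr.2)%:F i))) acc) R0 l).

Definition in_closed_cone (w : 'I_d -> R) : Prop :=
  forall eps, Rlt R0 eps ->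
    exists w', in_cone w' /\ forall i, Rlt (Rabs (Rminus (w i) (w' i))) eps.

Definition OK_relative (m : D -> Prop) : Prop :=
  (forall r : D, val_ring r%:F) /\ (forall r : D, m r <-> val_max r%:F) /\
  (forall u : 'I_d -> R, in_closed_cone u ->
      ~ ((exists i, u i <> R0) /\ Rle (rdot u a) R0)) /\
  (* (iii) [k_V : k] < oo : k_V = V/m_V is spanned over k = D/m by finitely
     many elements *)
  (exists s : seq F, (forall v, v \in s -> val_ring v) /\
     forall v, val_ring v -> exists c : seq D, size c = size s /\
        val_max (v - \sum_(pr <- zip c s) (pr.1)%:F * pr.2)) /\
  (exists v : zvec d, forall (n : nat) (x : D),
      F_ge (zscale n v) x%:F -> ideal_pow m n x).
End Valuation.

Definition OK_domain (D : idomainType) (d : nat) (m : D -> Prop) : Prop :=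
  exists (a : 'I_d -> R) (nu : {fraction D} -> zvec d),
    Q_lin_indep a /\ is_valuation a nu /\ OK_relative a nu m.

(* Main.v *)
Require Import Defs.
From Stdlib Require Import Reals.
From Stdlib Require QArith_base ClassicalEpsilon.
From HB Require Import structures.
From mathcomp Require Import all_boot all_order all_algebra fraction finmap.
From mathcomp Require Import generic_quotient.
From mathcomp Require Import boolp classical_sets functions cardinality reals Rstruct.
From mathcomp Require Import topology normedtype.
From mathcomp Require Import ring lra zify ssrZ.
Set Implicit Arguments. Unset Strict Implicit. Unset Printing Implicit Defensive.
Import Order.TTheory GRing.Theory Num.Theory numFieldNormedType.Exports.
Local Open Scope quotient_scope.
Local Open Scope classical_set_scope.
Local Open Scope ring_scope.

(* Let S = nu(D \ 0), S_q = nu(I_q \ 0) and B = [k_V : k].  Counting ranks of graded pieces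
   of the valuation filtration gives l(D/I_q) = B #(S \ S_q) + o(q^d).  Call x in S excessive
   at scale T if x/T lies outside the p-body of I, that is, if there are no t, q with t x in S_q
   and t T <= q, and let N(T) be the number of such x.  Since S generates Z^d, it contains
   translates of all cells [0,k)^d, so N(k T) >= k^d (N(T) - o(T^d)); hence N(T) ~ V T^d for
   some V, and a further use of cells gives #(S \ S_q) ~ V q^d.  This is the existence of the
   volume, equal to B V.

   For the inequality let r_I(x) be the infimum of 1/T over the T at which x is not excessive.
   Then r_L <= r_I + r_J, and #{x : r(x) > 1/T} ~ V T^d.  The sum of r(x)^d over r(x) > 1/T
   grows like d V log T, so convexity of x -> x^d, applied to each x separately, gives
   V_L <= l^(1-d) V_I + n^(1-d) V_J whenever l + n = 1.  Optimising over l yields the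
   Minkowski inequality for the d-th roots.  Only lattice points are counted:
   Lebesgue measure and the boundary of the p-body never enter. *)

(** * Asymptotic densities *)

(** The p-body absorbs the cone of values but need not be convex, so Brunn-Minkowski for convex
    bodies gives nothing here. Its complement in the cone is however star-shaped with radial
    function r, homogeneous of degree -1, and V plays the role of 1/d times the integral of r^d over
    directions. The inequality is then the triangle inequality in L^d for r_L <= r_I + r_J; the
    parameter l linearises it, convexity being used at r_I / l and r_J / n, whence the factors
    l^(1-d). No integral over directions is formed. Summing r^d over lattice points replaces it: by
    homogeneity each shell between consecutive geometric scales contributes about the same amount,
    so the sum grows like log T, with the wanted integral as slope. A slope ignores bounded errors,
    so the points with r_I or r_J large and the truncation at scale T cost nothing. The other errors
    are boundary layers: a translation by a fixed lattice vector changes heights by a bounded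
    amount, and a slab of bounded thickness contains o(T^d) points of S because S itself has a
    density. *)

Section Asymptotics.
Variables (R : realType) (d : nat).
Implicit Types (F G : R -> R) (V e T : R).

Definition asym F V := forall e, 0 < e ->
  exists T0, forall T, T0 <= T -> `|F T - V * T ^+ d| <= e * T ^+ d.

Lemma expr_shift w e : 0 < e ->
  exists2 T0, 1 <= T0 & forall T, T0 <= T -> `|(T + w) ^+ d - T ^+ d| <= e * T ^+ d.
Proof.
elim: d e => [|n IH] e e0.
  by exists 1 => // T _; rewrite !expr0 subrr normr0; lra.
have [] := IH (e / 4); first by lra.
(* The summands ensure [T1 <= T], [|T + w| <= 2 T] and [|w| <= e / 2 * T]; the two terms below then
   cost [e / 2] each. *)
move=> T1 T11 H1; exists (T1 + `|w| + `|w| * 2 / e).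
  by rewrite -addrA ler_wpDr // addr_ge0 // divr_ge0 ?mulr_ge0 // ltW.
move=> T hT.
have w0 : 0 <= `|w| * 2 / e by rewrite divr_ge0 ?mulr_ge0 // ltW.
have wp : 0 <= `|w| by [].
have {}/H1 H1 : T1 <= T by lra.
have T0 : 0 < T by lra.
have Tn : 0 <= T ^+ n by rewrite exprn_ge0 // ltW.
have -> : (T + w) ^+ n.+1 - T ^+ n.+1 = (T + w) * ((T + w) ^+ n - T ^+ n) + w * T ^+ n.
  by rewrite !exprS; ring.
apply: le_trans (ler_normD _ _) _; rewrite !normrM (ger0_norm Tn).
have h1 : `|T + w| <= 2 * T.
  by apply: le_trans (ler_normD _ _) _; rewrite (ger0_norm (ltW T0)); lra.
have h2 : `|w| <= e / 2 * T.
  have : `|w| * 2 / e <= T by lra.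
  by rewrite ler_pdivrMr //; lra.
have h3 : `|T + w| * `|(T + w) ^+ n - T ^+ n| <= 2 * T * (e / 4 * T ^+ n).
  exact: ler_pM.
have h4 : `|w| * T ^+ n <= e / 2 * T * T ^+ n by exact: ler_wpM2r.
rewrite exprS; lra.
Qed.

(** The limit does not see the shift [w]. By [asymB], two shifts with the same slope [c] therefore
    differ by o(T^d): this is how slabs of bounded thickness are discarded. *)
Lemma asym_affine F V c w : 0 < c -> asym F V ->
  asym (fun T => F (c * T + w)) (V * c ^+ d).
Proof.
move=> c0 hF e e0.
have cd : 0 < c ^+ d by rewrite exprn_gt0.
(* Three shares of [e / 3]: two for [e1 * x], as [x <= 2 * y], and one for [V * (x - y)], which [e2]
   controls. *)
set e1 := e / (3 * c ^+ d).
have e1p : 0 < e1 by rewrite divr_gt0 // mulr_gt0.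
set e2 := Num.min 1 (e / (3 * c ^+ d * (`|V| + 1))).
have Vp : 0 < `|V| + 1 by rewrite ltr_wpDl.
have e2p : 0 < e2 by rewrite lt_min ltr01 divr_gt0 // !mulr_gt0.
have [T1 H1] := hF _ e1p; have [T2 T21 H2] := expr_shift w e2p.
exists (T2 / c + `|T1| / c + `|w| / c) => T hT.
have hT' : T2 + `|T1| + `|w| <= c * T by rewrite -!mulrDl ler_pdivrMr // mulrC in hT.
have T1p : T1 <= `|T1| by exact: ler_norm.
have := normr_ge0 T1; have := normr_ge0 w => wp T1p'.
have wl : - `|w| <= w by rewrite lerNl -normrN ler_norm.
have {}/H1 H1 : T1 <= c * T + w by lra.
have {}/H2 H2 : T2 <= c * T by lra.
move: H1 H2; rewrite exprMn; set x := (_ + w) ^+ d; set y := c ^+ d * T ^+ d.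
have y0 : 0 <= y by rewrite mulr_ge0 ?exprn_ge0 ?(ltW cd) //; nra.
move=> H1 H2.
have e2l1 : e2 <= 1 by rewrite /e2 ge_min lexx.
have e2l2 : (`|V| + 1) * e2 <= e / (3 * c ^+ d).
  have : e2 <= e / (3 * c ^+ d * (`|V| + 1)) by rewrite /e2 ge_min lexx orbT.
  by rewrite invfM mulrA ler_pdivlMr // mulrC.
have hx : x <= 2 * y.
  have : e2 * y <= 1 * y by exact: ler_wpM2r.
  by move: H2; rewrite ler_norml => /andP[_]; lra.
have E : e * T ^+ d = 3 * (e1 * y) by rewrite /e1 /y; field; rewrite lt0r_neq0.
have -> : F (c * T + w) - V * c ^+ d * T ^+ d = (F (c * T + w) - V * x) + V * (x - y).
  by rewrite /y; ring.
apply: le_trans (ler_normD _ _) _.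
have h1 : e1 * x <= e1 * (2 * y) by rewrite ler_pM2l.
have h2 : `|V * (x - y)| <= e1 * y.
  rewrite normrM.
  have h3 : `|V| * `|x - y| <= (`|V| + 1) * (e2 * y) by apply: ler_pM => //; lra.
  apply: le_trans h3 _; rewrite mulrA; apply: ler_wpM2r => //.
lra.
Qed.

Lemma asymB F G V W : asym F V -> asym G W -> asym (fun T => F T - G T) (V - W).
Proof.
move=> hF hG e e0; have e2 : 0 < e / 2 by lra.
have [T1 H1] := hF _ e2; have [T2 H2] := hG _ e2.
exists (Num.max T1 T2) => T; rewrite ge_max => /andP[/H1 {}H1 /H2 {}H2].
have -> : F T - G T - (V - W) * T ^+ d = (F T - V * T ^+ d) - (G T - W * T ^+ d) by ring.
by apply: le_trans (ler_normB _ _) _; lra.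
Qed.

(* [F m T >= m^d (F T - o(T^d))] is superadditivity in disguise: the limit is the
   upper density of F, and monotonicity fills the gaps between multiples of a good T. *)
Lemma asym_superhomogeneous F K :
  {homo F : S T / S <= T} -> (forall T, 0 <= F T) ->
  (forall T, 1 <= T -> F T <= K * T ^+ d) ->
  (forall e, 0 < e -> exists T0, forall T m, T0 <= T -> (0 < m)%N ->
      m%:R ^+ d * (F T - e * T ^+ d) <= F (m%:R * T)) ->
  exists2 V, 0 <= V & asym F V.
Proof.
move=> Fm F0 FK Fs.
pose A := [set v : R | forall T0, exists2 T, T0 <= T & v * T ^+ d <= F T]%classic.
have A0 : A 0 by move=> T0; exists T0 => //; rewrite mul0r.
have AK v : A v -> v <= K.
  move=> /(_ 1) [T T1 hv].
  have Tp : 0 < T ^+ d by rewrite exprn_gt0 // (lt_le_trans ltr01).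
  by rewrite -(ler_pM2r Tp); apply: le_trans hv (FK _ T1).
have hs : has_sup A by split; [exists 0 | exists K].
pose V := sup A.
have ubV v : A v -> v <= V by exact: (ub_le_sup (proj2 hs)).
have V0 : 0 <= V by exact: ubV.
exists V => // e e0.
have [T1 H1] : exists T1, forall T, T1 <= T -> F T <= (V + e) * T ^+ d.
  apply: contrapT => /forallNP h.
  have : A (V + e).
    move=> T0; have /existsNP [T /not_implyP [h1 h2]] := h T0.
    by exists T => //; rewrite ltW // ltNge; apply/negP.
  by move/ubV; lra.
have e4 : 0 < e / 4 by lra.
have [T2 H2] := Fs _ e4.
have [v Av hv] : exists2 v, A v & V - e / 4 < v.
  by have [v Av hv] := sup_adherent e4 hs; exists v.
have [X] := Av (Num.max 1 T2); rewrite ge_max => /andP[X1 X2] hX.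
(* Makes [V * e3 <= e / 4], the loss in passing from [T] to [T - X <= m%:R * X]. *)
pose e3 := Num.min 1 (e / (4 * (V + 1))).
have e3p : 0 < e3 by rewrite lt_min ltr01 divr_gt0 //; lra.
have [T3 T31 H3] := expr_shift (- X) e3p.
exists (Num.max T1 (T3 + X)) => T; rewrite ge_max => /andP[hT1 hT3].
have Td : 0 <= T ^+ d by rewrite exprn_ge0 //; lra.
have {}H1 := H1 _ hT1.
suff H : (V - e) * T ^+ d <= F T by rewrite ler_norml; apply/andP; split; lra.
have {}/H3 H3 : T3 <= T by lra.
have X0 : 0 < X by lra.
set m := Num.truncn (T / X).
have TX : 1 <= T / X by rewrite ler_pdivlMr //; lra.
have [hm1 hm2] : (m%:R * X <= T) /\ (T < m.+1%:R * X).
  rewrite -ler_pdivlMr // -ltr_pdivrMr //; split.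
    by rewrite truncn_le //; lra.
  exact: truncnS_gt.
have m0 : (0 < m)%N by rewrite /m truncn_gt0.
have h := H2 X m X2 m0.
have {}hm1 := Fm _ _ hm1.
(* For [V < e / 2] the lower bound is negative and trivial; otherwise the factor [V - e / 2] may
   multiply inequalities. *)
case: (ltP (V - e / 2) 0) => Vs.
  apply: le_trans (F0 T); rewrite mulr_le0_ge0 //; lra.
have Xd : 0 <= X ^+ d by rewrite exprn_ge0 // ltW.
have h4 : (V - e / 2) * X ^+ d <= F X - e / 4 * X ^+ d.
  have : (V - e / 4) * X ^+ d <= v * X ^+ d by rewrite ler_wpM2r // ltW.
  lra.
have md : 0 <= (m%:R : R) ^+ d by rewrite exprn_ge0.
have h5 : m%:R ^+ d * ((V - e / 2) * X ^+ d) <= F T.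
  by apply: le_trans hm1; apply: le_trans h; apply: ler_wpM2l.
have h6 : (T - X) ^+ d <= m%:R ^+ d * X ^+ d.
  rewrite -exprMn lerXn2r ?nnegrE //; first by lra.
    by rewrite mulr_ge0 // ltW.
  by move: hm2; rewrite -natr1 mulrDl mul1r; lra.
have h7 : (V - e / 2) * (T - X) ^+ d <= F T.
  apply: le_trans h5; rewrite mulrCA; exact: ler_wpM2l.
have h8 : (1 - e3) * T ^+ d <= (T - X) ^+ d.
  by move: H3; rewrite ler_norml => /andP[]; lra.
have h9 : (V - e / 2) * ((1 - e3) * T ^+ d) <= F T.
  by apply: le_trans h7; apply: ler_wpM2l.
apply: le_trans h9; rewrite mulrA; apply: ler_wpM2r => //.
have h10 : V * e3 <= e / 4.
  have : e3 <= e / (4 * (V + 1)) by rewrite /e3 ge_min lexx orbT.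
  by rewrite invfM mulrA ler_pdivlMr; nra.
nra.
Qed.

End Asymptotics.

(** * Counting in lattice semigroups *)

Section Counting.
Variable T : choiceType.
Implicit Types A B P : set T.

(** [fset_set] sends an infinite set to the empty one, so the count is meaningful for finite sets
    only; hence the finiteness hypotheses below. *)
Definition ncard A : nat := #|` fset_set A|.

Lemma ncard_sub A B : finite_set B -> A `<=` B -> (ncard A <= ncard B)%N.
Proof.
move=> fB AB; have fA := sub_finite_set AB fB.
apply: fsubset_leq_card; apply/fsubsetP => x.
by rewrite !in_fset_set // !inE; apply: AB.
Qed.

Lemma ncard_split P A : finite_set A ->
  ncard A = (ncard (A `&` P) + ncard (A `&` ~` P))%N.
Proof.
move=> fA; rewrite /ncard -{1}(setIT A) -(setUv P) setIUr.
have f1 : finite_set (A `&` P) by exact: finite_setIl.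
have f2 : finite_set (A `&` ~` P) by exact: finite_setIl.
rewrite fset_setU // cardfsU.
suff -> : (fset_set (A `&` P) `&` fset_set (A `&` ~` P))%fset = fset0.
  by rewrite cardfs0 subn0.
rewrite -fset_setI //; suff -> : A `&` P `&` (A `&` ~` P) = set0 by rewrite fset_set0.
by rewrite setIACA setICr setI0.
Qed.

Lemma ncard_cells (I : finType) (f : T -> I -> T) A B :
  (forall x y i j, f x i = f y j -> x = y /\ i = j) ->
  finite_set A -> finite_set B -> (forall x i, A x -> B (f x i)) ->
  (#|I| * ncard A <= ncard B)%N.
Proof.
move=> fI fA fB AB.
have inB (z : fset_set A * I) : f (val z.1) z.2 \in fset_set B.
  rewrite in_fset_set // inE; apply: AB.
  by have := valP z.1; rewrite in_fset_set // inE.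
pose g z : fset_set B := [` inB z]%fset.
have gI : injective g.
  move=> [x i] [y j] /(congr1 val) /= /fI [/val_inj -> ->] //.
have := leq_card g gI.
by rewrite card_prod -!cardfE mulnC.
Qed.

Lemma ncard_inj (f : T -> T) A B : injective f ->
  finite_set A -> finite_set B -> (forall x, A x -> B (f x)) -> (ncard A <= ncard B)%N.
Proof.
move=> fI fA fB AB; rewrite -[ncard A]mul1n -card_unit.
apply: (@ncard_cells unit (fun x _ => f x)) => //.
  by move=> x y [] [] /fI ->.
by move=> x _; apply: AB.
Qed.

Lemma sum_asbool A B : finite_set A ->
  (\sum_(x <- fset_set A) `[< B x >] = ncard (A `&` B))%N.
Proof.
move=> fA; rewrite -big_mkcond /= sum1_count -size_filter /ncard; apply: perm_size.
apply: uniq_perm; rewrite ?filter_uniq ?fset_uniq // => x.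
rewrite mem_filter !in_fset_set ?in_setI //; last exact: finite_setIl.
by rewrite andbC; congr (_ && _); apply/asboolP/idP; rewrite inE.
Qed.

End Counting.

Lemma int_div_inj (m b c : nat) (p q r : int) : (b < m)%N -> (c < m)%N ->
  p *+ m + r + b%:Z = q *+ m + r + c%:Z -> b = c.
Proof.
move=> hb hc; rewrite ![_ + r]addrC -!addrA => /addrI.
rewrite -[p *+ m]mulr_natr -[q *+ m]mulr_natr natz => /(congr1 (intdiv.modz^~ m%:Z)).
by rewrite !intdiv.modzMDl !intdiv.modz_nat !modn_small // => -[].
Qed.

Section Semigroup.
Variables (R : realType) (d : nat) (h : {additive 'rV[int]_d -> R}) (S : set 'rV[int]_d).
Local Notation L := 'rV[int]_d.
Implicit Types (x y u v w : L) (X Y T : R).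

Definition below X : set L := [set u | S u /\ h u < X].

(** An axiomatic copy of the values of [D \ 0] with their heights. Growth is only bounded above
    here; generation of the whole lattice upgrades it to a density in [gsg_density]. *)
Record good_semigroup := GoodSemigroup {
  gsg0 : S 0;
  gsgD : forall u v, S u -> S v -> S (u + v);
  gsg_gen : forall u, exists v w, [/\ S v, S w & u = v - w];
  gsg_ge0 : forall u, S u -> 0 <= h u;
  gsg_fin : forall X, finite_set (below X);
  gsg_growth : exists K, forall T, 1 <= T -> (ncard (below T))%:R <= K * T ^+ d }.

Definition cell m (b : {ffun 'I_d -> 'I_m}) : L := \row_i (b i : nat)%:Z.

Hypothesis gS : good_semigroup.
Let S0 := gsg0 gS.
Let SD := gsgD gS.

Lemma gsgMn x n : S x -> S (x *+ n).
Proof. by move=> Sx; elim: n => [|n IH]; rewrite ?mulr0n // mulrS; apply: SD. Qed.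

Lemma gsg_sum (I : Type) (r : seq I) (f : I -> L) :
  (forall i, S (f i)) -> S (\sum_(i <- r) f i).
Proof. by move=> Sf; elim/big_rec: _ => // i x _; apply: SD. Qed.

Lemma cellE m (b : {ffun 'I_d -> 'I_m}) : cell b = \sum_i delta_mx 0 i *+ (b i).
Proof.
apply/rowP => j; rewrite !mxE summxE (bigD1 j) //= big1 ?addr0.
  by rewrite mulmxnE mxE !eqxx mulr1n natz.
by move=> i ij; rewrite mulmxnE mxE eqxx /= eq_sym (negbTE ij) mul0rn.
Qed.

Lemma gsg_cells : exists v w, [/\ S v, S w &
  forall m (b : {ffun 'I_d -> 'I_m}), S (v *+ m + cell b) /\ S (w *+ m - cell b)].
Proof.
have /choice [s] : forall i : 'I_d, exists vw : L * L,
    [/\ S vw.1, S vw.2 & delta_mx 0 i = vw.1 - vw.2].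
  by move=> i; have [v [w vw]] := gsg_gen gS (delta_mx 0 i); exists (v, w).
move=> hs.
exists (\sum_i (s i).2), (\sum_i (s i).1); split.
- by apply: gsg_sum => i; have [] := hs i.
- by apply: gsg_sum => i; have [] := hs i.
move=> m b; rewrite cellE -!sumrMnl -big_split -sumrB /=; split; apply: gsg_sum => i;
    have [s1 s2 ->] := hs i; have : (b i <= m)%N by apply: ltnW.
  all: move: (nat_of_ord (b i)) => k km.
- rewrite -(subnK km) mulrnDr mulrnBl -addrA [X in _ + X]addrC subrK.
  by apply: SD; apply: gsgMn.
- rewrite -(subnK km) mulrnDr mulrnBl opprB addrACA subrr addr0.
  by apply: SD; apply: gsgMn.
Qed.

(** Once [w *+ 1] is removed, the cell position and the point are the remainder and the quotient of
    division by m in each coordinate. *)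
Lemma cell_inj m (x y : L) (b c : {ffun 'I_d -> 'I_m}) (w : L) :
  x *+ m + w + cell b = y *+ m + w + cell c -> x = y /\ b = c.
Proof.
move=> E.
have bc : b = c.
  apply/ffunP => i; apply: val_inj; move/rowP: E => /(_ i); rewrite !mxE !mulmxnE.
  exact: int_div_inj.
split=> //; move: E; rewrite bc => /addIr /addIr E.
apply/rowP => i; move/rowP: E => /(_ i); rewrite !mulmxnE.
(* For [m = 0] the digit [b i] would inhabit ['I_0]. *)
have [m0|m0] := posnP m; last first.
  by move/eqP; rewrite -subr_eq0 -mulrnBl mulrn_eq0 -leqn0 leqNgt m0 /= subr_eq0 => /eqP.
by exfalso; have := leq_ltn_trans (leq0n _) (ltn_ord (b i)); rewrite m0.
Qed.

Definition cell_bound : R := \sum_i `|h (delta_mx 0 i)|.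

Lemma cell_bound_ge0 : 0 <= cell_bound. Proof. by apply: sumr_ge0. Qed.

Lemma h_cell m (b : {ffun 'I_d -> 'I_m}) : `|h (cell b)| <= m%:R * cell_bound.
Proof.
rewrite cellE raddf_sum; apply: le_trans (ler_norm_sum _ _ _) _.
rewrite mulr_sumr; apply: ler_sum => i _; rewrite raddfMn normrMn -[_ *+ b i]mulr_natl.
by apply: ler_wpM2r => //; rewrite ler_nat ltnW.
Qed.

Lemma ncard_fill v A B m : finite_set A -> finite_set B ->
  (forall (b : {ffun 'I_d -> 'I_m}) x, A x -> B (x *+ m + (v *+ m + cell b))) ->
  (m ^ d * ncard A <= ncard B)%N.
Proof.
move=> fA fB AB.
have := @ncard_cells _ {ffun 'I_d -> 'I_m} (fun x b => x *+ m + (v *+ m + cell b)) A B.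
rewrite card_ffun !card_ord; apply=> //; last by move=> x b; apply: AB.
by move=> x y b c; rewrite !addrA => /cell_inj.
Qed.

(** The mirror image of [ncard_fill]: excessive points are stable under subtracting elements of S,
    not under adding them. *)
Lemma ncard_fillN v A B m : finite_set A -> finite_set B ->
  (forall (b : {ffun 'I_d -> 'I_m}) x, A x -> B (x *+ m - (v *+ m + cell b))) ->
  (m ^ d * ncard A <= ncard B)%N.
Proof.
move=> fA fB AB.
have := @ncard_cells _ {ffun 'I_d -> 'I_m} (fun x b => x *+ m - (v *+ m + cell b)) A B.
rewrite card_ffun !card_ord; apply=> //; last by move=> x b; apply: AB.
move=> x y b c /(congr1 (fun z => z + (v *+ m + cell b) + (v *+ m + cell c))).
by rewrite subrK addrAC subrK !addrA => /cell_inj [-> ->].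
Qed.

Lemma below_mono X Y : X <= Y -> below X `<=` below Y.
Proof. by move=> XY x [Sx hx]; split => //; apply: lt_le_trans XY. Qed.

(** Filling the cells at the n-fold multiples of points below T stays below n T up to an error
    proportional to n, so the counting function is superhomogeneous after a shift of its argument;
    [asym_affine] undoes the shift. *)
Lemma gsg_density : exists2 s, 0 <= s & asym d (fun X => (ncard (below X))%:R) s.
Proof.
have [v [w [Sv Sw vw]]] := gsg_cells.
have [K hK] := gsg_growth gS.
have fin := gsg_fin gS.
have C1 := cell_bound_ge0; have hv := gsg_ge0 gS Sv.
(* The cell raises the height by at most [n * c0 / 2], while the shifted argument gains [n * c0];
   the surplus [n * c0 / 2] covers the [c0] required on the right once [n >= 2]. *)
pose c0 := 2 * (h v + cell_bound).
have c00 : 0 <= c0 by rewrite /c0; lra.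
have mono X Y : X <= Y -> (ncard (below X))%:R <= (ncard (below Y))%:R :> R.
  by move=> XY; rewrite ler_nat; apply: ncard_sub => //; apply: below_mono.
have [s s0 hs] : exists2 s, 0 <= s & asym d (fun X => (ncard (below (X - c0)))%:R) s.
  apply: (@asym_superhomogeneous R d _ K) => //.
  - by move=> X Y XY; apply: mono; lra.
  - by move=> T T1; apply: le_trans (hK _ T1); apply: mono; lra.
  move=> e e0; exists 1 => T [|[|n']] T1 // _.
    by rewrite !mul1r expr1n mul1r gerBl mulr_ge0 ?exprn_ge0 ?(ltW e0) //; lra.
  have : 2 <= n'.+2%:R :> R by rewrite ler_nat.
  move: n'.+2 => n n2.
  apply: (@le_trans _ _ (n%:R ^+ d * (ncard (below (T - c0)))%:R)).
    apply: ler_wpM2l; first by rewrite exprn_ge0.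
    by rewrite gerBl mulr_ge0 ?exprn_ge0 ?(ltW e0) //; lra.
  rewrite -natrX -natrM ler_nat.
  apply: (@ncard_fill v) => // b x [Sx hx]; split.
    by apply: SD; [exact: gsgMn | have [] := vw _ b].
  rewrite !raddfD !raddfMn -[h x *+ n]mulr_natl -[h v *+ n]mulr_natl.
  have := h_cell b; rewrite ler_norml => /andP[_ hb].
  apply: le_lt_trans (lerD (lexx _) (lerD (lexx _) hb)) _.
  have h1 : n%:R * h x < n%:R * (T - c0) by rewrite ltr_pM2l //; lra.
  have h2 : 2 * c0 <= n%:R * c0 by apply: ler_wpM2r.
  have -> : n%:R * cell_bound = n%:R * c0 / 2 - n%:R * h v by rewrite /c0; field.
  lra.
exists s => //.
have := asym_affine c0 (ltr01 : 0 < (1 : R)) hs; rewrite expr1n mulr1.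
by congr (asym _ _ _); apply/funext => X; rewrite mul1r addrK.
Qed.

End Semigroup.

(** * p-families of exponents *)

Section PFamily.
Variables (R : realType) (d : nat) (h : {additive 'rV[int]_d -> R}) (S : set 'rV[int]_d).
Local Notation L := 'rV[int]_d.
Hypothesis gS : good_semigroup h S.
Let SD := gsgD gS.
Local Notation below := (below h S).
Variable p : nat.
Hypothesis p1 : (1 < p)%N.

Lemma expr_pgt0 e : 0 < (p%:R : R) ^+ e.
Proof. by rewrite exprn_gt0 // ltr0n ltnW. Qed.

Lemma exprp_unbounded (T : R) : exists e0, forall e, (e0 <= e)%N -> T <= p%:R ^+ e.
Proof.
exists (Num.truncn T).+1 => e he.
apply: le_trans (ltW (truncnS_gt T)) _.
by rewrite -natrX ler_nat (leq_trans he) // ltnW // ltn_expl.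
Qed.

Lemma exprp_between (T : R) : 1 <= T -> exists e, T <= p%:R ^+ e <= p%:R * T.
Proof.
move=> T1; have [e0 he0] := exprp_unbounded T.
have ex : exists e, T <= (p%:R : R) ^+ e by exists e0; apply: he0.
exists (ex_minn ex); case: ex_minnP => e -> /= hm.
case: e hm => [|e] hm.
  have : 1 <= p%:R :> R by rewrite ler1n ltnW.
  by rewrite expr0; nra.
rewrite exprS ler_wpM2l //; rewrite leNgt; apply/negP => /ltW /hm.
by rewrite ltnn.
Qed.

(* What is used of the sets [nu (I_q \ 0)] for a p-family of ideals, indexed by e with q = p^e. *)
Record exponent_family (Se : nat -> set L) (c : R) := ExponentFamily {
  ef_gt0 : 0 < c;
  ef_sub : forall e, Se e `<=` S;
  ef_add : forall e x y, Se e x -> S y -> Se e (x + y);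
  ef_frob : forall e x, Se e x -> Se e.+1 (x *+ p);
  ef_big : forall e x, S x -> c * p%:R ^+ e <= h x -> Se e x }.

(* [scaled Se T x] says that x / T lies in the union of the sets Se / q; clearing the
   denominators leaves only integral multiples of x. *)
Definition scaled (Se : nat -> set L) (T : R) : set L :=
  [set x | exists e t, Se e (x *+ t) /\ t%:R * T <= p%:R ^+ e].

Definition excess Se T : set L := S `&` ~` scaled Se T.

Definition Nexc Se T : R := (ncard (excess Se T))%:R.

Section OneFamily.
Variables (Se : nat -> set L) (c : R).
Hypothesis fS : exponent_family Se c.
Implicit Types (T : R) (x y : L).

Lemma ef_frobn e j x : Se e x -> Se (e + j)%N (x *+ p ^ j).
Proof.
move=> Sx; elim: j => [|j IH]; first by rewrite addn0 expn0.
by rewrite addnS expnSr mulrnA; apply: (ef_frob fS).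
Qed.

(** Rounding T up to the next power of p costs the factor [p]; from that height on, [ef_big] applies
    and the multiple 1 of x is enough. *)
Lemma excess_below T : 1 <= T -> excess Se T `<=` below (c * p%:R * T).
Proof.
move=> T1 x [Sx nU]; split=> //; rewrite ltNge; apply/negP => hx; apply: nU.
have [e /andP[he1 he2]] := exprp_between T1.
exists e, 1%N; split; last by rewrite mul1r.
rewrite mulr1n; apply: (ef_big fS) => //; apply: le_trans hx.
by rewrite -mulrA ler_pM2l // (ef_gt0 fS).
Qed.

Lemma excess_mono T T' : T <= T' -> excess Se T `<=` excess Se T'.
Proof.
move=> TT x [Sx nU]; split=> // -[e [t [St ht]]]; apply: nU; exists e, t; split=> //.
by apply: le_trans ht; apply: ler_wpM2l.
Qed.

Lemma excess_finite T : finite_set (excess Se T).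
Proof.
apply: (@sub_finite_set _ _ (below (c * p%:R * Num.max T 1))); last exact: (gsg_fin gS).
apply: subset_trans (excess_below _); last by rewrite le_max lexx orbT.
by apply: excess_mono; rewrite le_max lexx.
Qed.

Lemma Nexc_mono : {homo Nexc Se : T T' / T <= T'}.
Proof.
move=> T T' TT; rewrite ler_nat; apply: ncard_sub; first exact: excess_finite.
exact: excess_mono.
Qed.

Lemma scaled_add T x y : scaled Se T x -> S y -> scaled Se T (x + y).
Proof.
move=> [e [t [St ht]]] Sy; exists e, t; split=> //.
by rewrite mulrnDl; apply: (ef_add fS) => //; apply: (gsgMn gS).
Qed.

Lemma scaled_mul T m x : scaled Se (m%:R * T) (x *+ m) -> scaled Se T x.
Proof.
move=> [e [t [St ht]]]; exists e, (m * t)%N; split; first by rewrite mulrnA.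
by rewrite natrM [m%:R * _]mulrC -mulrA.
Qed.

(** If x is excessive at scale T, any point of S obtained from [x *+ m] by subtracting an element of
    S is excessive at scale m T: otherwise adding that element back would make [x *+ m]
    non-excessive. Subtracting [v *+ m + cell b] yields m^d such points, as long as the result stays
    in S. *)
Lemma Nexc_asym : exists2 V, 0 <= V & asym d (Nexc Se) V.
Proof.
have [K hK] := gsg_growth gS.
have c0 := ef_gt0 fS.
have p0 : 1 <= p%:R :> R by rewrite ler1n ltnW.
(* The maximum with 1 keeps [c' * T >= 1], as the growth bound requires. *)
set c' := Num.max 1 (c * p%:R).
have c'1 : 1 <= c' by rewrite le_max lexx.
have Eb T : 1 <= T -> excess Se T `<=` below (c' * T).
  move=> T1; apply: subset_trans (excess_below T1) _; apply: below_mono.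
  by rewrite ler_wpM2r ?le_max ?lexx ?orbT //; lra.
have fin := gsg_fin gS.
apply: (@asym_superhomogeneous R d _ (K * c' ^+ d)).
- exact: Nexc_mono.
- by move=> T; rewrite ler0n.
- move=> T T1; apply: (@le_trans _ _ (ncard (below (c' * T)))%:R).
    by rewrite ler_nat; apply: ncard_sub => //; apply: Eb.
  rewrite -mulrA -exprMn; apply: hK; nra.
move=> e e0.
have [v [w [Sv Sw vw]]] := gsg_cells gS.
have [s s0 hs] := gsg_density gS.
have Svw : S (v + w) by exact: SD.
have c'0 : 0 < c' by lra.
have [T0 hT0] := asymB (asym_affine 0 c'0 hs) (asym_affine (- h (v + w)) c'0 hs) e0.
exists (Num.max 1 T0) => T m; rewrite ge_max => /andP[T1 {}/hT0 hT] m0.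
move: hT; rewrite subrr mul0r subr0 addr0 => hT.
(* For points satisfying [P] the whole subtracted cell stays in S. The others are few: translation
   by [v + w] embeds [below (c' * T - h (v + w))] into the part of [below (c' * T)] satisfying [P],
   and the two counts differ by o(T^d). *)
pose P : set L := [set x | S (x - (v + w))].
have hP : (ncard (below (c' * T) `&` ~` P))%:R <= e * T ^+ d.
  apply: le_trans (ler_norm _) _; apply: le_trans hT.
  rewrite (ger0_norm (ler0n _ _)); apply: le_trans (ler_norm _).
  rewrite lerBrDr -natrD ler_nat.
  rewrite (@ncard_split _ P (below (c' * T))) // addnC leq_add2r.
  apply: (@ncard_inj _ (fun x => x + (v + w))) => //.
  - exact: addIr.
  - exact: finite_setIl.
  move=> x [Sx hx]; split; last by rewrite /P /= addrK.
  by split; [exact: SD | rewrite raddfD; lra].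
have fE := excess_finite T.
have h1 : Nexc Se T - e * T ^+ d <= (ncard (excess Se T `&` P))%:R.
  rewrite /Nexc (@ncard_split _ P _ fE) natrD.
  suff : (ncard (excess Se T `&` ~` P))%:R <= e * T ^+ d by lra.
  apply: le_trans hP; rewrite ler_nat; apply: ncard_sub; first exact: finite_setIl.
  by apply: setSI; apply: Eb.
apply: (@le_trans _ _ (m%:R ^+ d * (ncard (excess Se T `&` P))%:R)).
  by apply: ler_wpM2l => //; rewrite exprn_ge0.
rewrite /Nexc -natrX -natrM ler_nat; apply: (@ncard_fillN _ v).
- exact: finite_setIl.
- exact: excess_finite.
move=> b x [[Sx nU] Px]; have [Sv' Sw'] := vw _ b.
have Sz : S (x *+ m - (v *+ m + cell b)).
  have -> : x *+ m - (v *+ m + cell b) = (x - (v + w)) *+ m + (w *+ m - cell b).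
    by rewrite !mulrnBl mulrnDl !opprD !addrA subrK addrAC.
  by apply: SD => //; apply: (gsgMn gS).
split=> // Uz; apply: nU; apply: (@scaled_mul _ m).
by rewrite -(subrK (v *+ m + cell b) (x *+ m)); apply: scaled_add.
Qed.

(** Frobenius brings [x *+ t] to level [e + k] as the multiple [t * p ^ j] of x, with
    [t * p ^ j <= p ^ k]; the missing copies of x are added inside S. Membership in the p-body,
    witnessed at one level, thus holds at all high levels. *)
Lemma scaled_eventually e x : S x -> scaled Se (p%:R ^+ e) x ->
  exists k0, forall k, (k0 <= k)%N -> Se (e + k)%N (x *+ p ^ k).
Proof.
move=> Sx [e' [t [St ht]]]; exists e' => k he'.
have := @ef_frobn _ (e + k - e') _ St; rewrite subnKC; last first.
  by apply: leq_trans he' _; rewrite leq_addl.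
set j := (e + k - e')%N; rewrite -mulrnA => Sz.
have htk : (t * p ^ j <= p ^ k)%N.
  have p0 : (0 < p ^ e)%N by rewrite expn_gt0 ltnW.
  rewrite -(leq_pmul2l p0) mulnCA -!expnD.
  have -> : (e + k = e' + j)%N by rewrite /j; lia.
  rewrite !expnD mulnA leq_mul2r.
  by move: ht; rewrite -!natrX -natrM ler_nat => ->; rewrite orbT.
rewrite -(subnKC htk) mulrnDr; apply: (ef_add fS) => //; exact: (gsgMn gS).
Qed.

Lemma ef_compl_below e : S `&` ~` Se e `<=` below (c * p%:R ^+ e).
Proof.
move=> x [Sx nSx]; split=> //; rewrite ltNge; apply/negP => hx; apply: nSx.
exact: (ef_big fS).
Qed.

Definition ncompl e : nat := ncard (S `&` ~` Se e).

(** Excessive points at scale q lie outside S_q, whence the lower bound. For the upper one, fix a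
    large level [e1]: finitely many non-excessive points lie below [c * q], their multiples by
    [p ^ k] lie in [Se (e1 + k)] for all large k, and filling their cells bounds that set from
    below. *)
Lemma ncompl_cvg V : asym d (Nexc Se) V -> forall eps, 0 < eps ->
  exists e0, forall e, (e0 <= e)%N ->
    `|(ncompl e)%:R - V * (p%:R ^+ e) ^+ d| <= eps * (p%:R ^+ e) ^+ d.
Proof.
move=> hV eps eps0.
have fin := gsg_fin gS; have c0 := ef_gt0 fS.
have [s s0 hs] := gsg_density gS.
have [v [w [Sv Sw vw]]] := gsg_cells gS.
have hv := gsg_ge0 gS Sv; have cb := cell_bound_ge0 h.
set c1 := h v + cell_bound h.
have cd : 0 < c ^+ d by rewrite exprn_gt0.
(* The error will be [eta] from the excess count plus [c ^+ d] times
   [(s + eta) * (1 + eta) - (s - eta)], which is at most [eta * (s + 3)] as [eta <= 1]. *)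
set D := 1 + c ^+ d * (s + 3).
have D0 : 0 < D by rewrite /D; nra.
set eta := Num.min 1 (eps / D).
have eta0 : 0 < eta by rewrite lt_min ltr01 divr_gt0.
have eta1 : eta <= 1 by rewrite ge_min lexx.
have etaD : eta * D <= eps by rewrite -ler_pdivlMr // ge_min lexx orbT.
have [T1 H1] := hs _ eta0; have [T2 H2] := hV _ eta0.
have [T3 T31 H3] := expr_shift d c1 eta0.
have [T4 H4] := hV _ eps0.
have [e1 he1] := exprp_unbounded (Num.max (T1 / c) (Num.max T2 (T3 / c))).
have [e2 he2] := exprp_unbounded T4.
have fG e : finite_set (S `&` ~` Se e) by apply: sub_finite_set (fin _); exact: ef_compl_below.
have : exists k0, forall k, (k0 <= k)%N ->
    (ncompl (e1 + k))%:R <= (V + eps) * (p%:R ^+ (e1 + k)) ^+ d.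
  set q : R := p%:R ^+ e1.
  have q0 : 0 < q by exact: expr_pgt0.
  have := he1 _ (leqnn e1); rewrite !ge_max -/q !ler_pdivrMr // ![q * c]mulrC.
  move=> /and3P[hq1 hq2 hq3].
  (* All points below [c * q] except at most [Nexc Se q] of them. *)
  set A := below (c * q) `&` scaled Se q.
  have fA : finite_set A by exact: finite_setIl.
  have /choice [kx hkx] : forall x, exists k0, A x -> forall k, (k0 <= k)%N ->
      Se (e1 + k)%N (x *+ p ^ k).
    move=> x; have [[[Sx _] Ux]|nA] := pselect (A x); last by exists 0%N.
    by have [k0 hk0] := scaled_eventually Sx Ux; exists k0.
  exists (\max_(x <- fset_set A) kx x)%N => k hk.
  have {hkx hk} hA x : A x -> Se (e1 + k)%N (x *+ p ^ k).
    move=> Ax; apply: (hkx) => //; apply: leq_trans hk.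
    by apply: leq_bigmax_seq => //; rewrite in_fset_set // inE.
  (* The term [c1] leaves room for the height of a cell, so the filled region stays below
     [r * Y]. *)
  set Y := c * q + c1; set r : R := p%:R ^+ k.
  have r1 : 1 <= r by rewrite exprn_ege1 // ler1n ltnW.
  have hfill : ((p ^ k) ^ d * ncard A <= ncard (below (r * Y) `&` Se (e1 + k)%N))%N.
    apply: (@ncard_fill _ v) => //; first exact: finite_setIl.
    move=> b x Ax; have [[Sx hx] Ux] := Ax; have [Sb _] := vw _ b.
    split; last by apply: (ef_add fS) => //; apply: hA.
    split; first by apply: SD => //; apply: (gsgMn gS).
    rewrite !raddfD !raddfMn -[h x *+ _]mulr_natl -[h v *+ _]mulr_natl natrX -/r.
    have := h_cell h b; rewrite ler_norml natrX -/r => /andP[_ hb].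
    have : r * h x < r * (c * q) by rewrite ltr_pM2l //; lra.
    by rewrite /Y /c1 !mulrDr; lra.
  have hN : (ncard (below (c * q)))%:R <= (ncard A)%:R + Nexc Se q.
    rewrite /Nexc -natrD ler_nat (@ncard_split _ (scaled Se q) (below (c * q))) //.
    rewrite leq_add2l; apply: ncard_sub; first exact: excess_finite.
    by move=> x [[Sx _] nU].
  have hG : (ncompl (e1 + k) + ncard (below (r * Y) `&` Se (e1 + k)%N) <=
             ncard (below (r * Y)))%N.
    rewrite [X in (_ <= X)%N](@ncard_split _ (Se (e1 + k)%N)) // addnC leq_add2l.
    apply: ncard_sub; first exact: finite_setIl.
    move=> x Ex; split; last by case: Ex.
    apply: below_mono (ef_compl_below Ex); rewrite exprD -/q -/r /Y.
    have : 0 <= r * c1 by rewrite mulr_ge0 // /c1; lra.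
    lra.
  have {hG hfill} hG : (ncompl (e1 + k))%:R + r ^+ d * (ncard A)%:R <= (ncard (below (r * Y)))%:R.
    have -> : r ^+ d = ((p ^ k) ^ d)%:R by rewrite /r !natrX.
    rewrite -natrM -natrD ler_nat; apply: leq_trans hG.
    by rewrite leq_add2l.
  have hY0 : c * q <= Y by rewrite /Y /c1; lra.
  have hY : Y ^+ d <= (1 + eta) * (c * q) ^+ d.
    have := H3 _ hq3; rewrite ler_norml -/Y => /andP[_].
    by move: (Y ^+ d) ((c * q) ^+ d) => y x; lra.
  have cq0 : 0 < c * q by exact: mulr_gt0.
  have hrY : T1 <= r * Y.
    have Y0 : 0 <= Y by exact: le_trans (ltW cq0) hY0.
    by apply: le_trans hq1 _; apply: le_trans hY0 _; rewrite ler_peMl.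
  have := H1 _ hrY; rewrite ler_norml exprMn => /andP[_ h1].
  have := H1 _ hq1; rewrite ler_norml => /andP[h2 _].
  have := H2 _ hq2; rewrite ler_norml => /andP[_ h3].
  have rd : 0 < r ^+ d by rewrite exprn_gt0 //; lra.
  have qd : 0 < q ^+ d by rewrite exprn_gt0.
  rewrite exprD -/q -/r [(q * r) ^+ d]exprMn.
  move: h2 hY; rewrite [(c * q) ^+ d]exprMn.
  clearbody eta.
  move: (Y ^+ d) (r ^+ d) (q ^+ d) (c ^+ d) rd qd cd hG h1 h3 hN @D D0 etaD => y rr qq cc.
  move: (ncompl _)%:R (ncard _)%:R (ncard _)%:R (ncard _)%:R (Nexc _ _) => n1 n2 n3 n4 n5.
  move=> rr0 qq0 cc0 g1 g2 g3 g4 D D0 etaD g5 g6.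
  have k1 : n3 <= (s + eta) * (rr * y) by lra.
  have k2 : rr * n4 >= rr * (n2 - n5) by rewrite ler_pM2l //; lra.
  have k3 : rr * (n2 - n5) >= rr * ((s - eta) * (cc * qq) - (V + eta) * qq).
    by rewrite ler_pM2l //; lra.
  have k4 : (s + eta) * (rr * y) <= (s + eta) * (rr * ((1 + eta) * (cc * qq))).
    by rewrite ler_wpM2l ?ler_pM2l //; lra.
  have k5 : n1 <= rr * qq * (V + eta + cc * ((s + eta) * (1 + eta) - (s - eta))).
    have -> : rr * qq * (V + eta + cc * ((s + eta) * (1 + eta) - (s - eta))) =
      (s + eta) * (rr * ((1 + eta) * (cc * qq))) - rr * ((s - eta) * (cc * qq) - (V + eta) * qq) by ring.
    by lra.
  apply: le_trans k5 _; rewrite mulrC [qq * rr]mulrC; apply: ler_wpM2r.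
    by rewrite mulr_ge0 // ltW.
  have k6 : (s + eta) * (1 + eta) - (s - eta) <= eta * (s + 3).
    have -> : (s + eta) * (1 + eta) - (s - eta) = eta * (s + 2 + eta) by ring.
    by rewrite ler_pM2l //; lra.
  have k7 : cc * ((s + eta) * (1 + eta) - (s - eta)) <= cc * (eta * (s + 3)) by rewrite ler_pM2l.
  rewrite -[V + eta + _]addrA lerD2l; apply: le_trans etaD.
  have -> : eta * D = eta + cc * (eta * (s + 3)) by rewrite /D; ring.
  by rewrite lerD2l.
move=> [k0 hk0]; exists (maxn (e1 + k0) e2) => e; rewrite geq_max => /andP[h1 h2].
have {}h1 : (ncompl e)%:R <= (V + eps) * (p%:R ^+ e) ^+ d.
  have e1e : (e1 <= e)%N := leq_trans (leq_addr _ _) h1.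
  by rewrite -(subnKC e1e); apply: hk0; rewrite leq_subRL.
have := H4 _ (he2 _ h2); rewrite ler_norml => /andP[h3 _].
have h4 : Nexc Se (p%:R ^+ e) <= (ncompl e)%:R.
  rewrite ler_nat; apply: ncard_sub => // x [Sx nU]; split=> // Sex; apply: nU.
  by exists e, 1%N; split; rewrite ?mulr1n // mul1r.
by rewrite ler_norml; apply/andP; split; lra.
Qed.

End OneFamily.
End PFamily.

(** * The Minkowski inequality for densities *)

Section Convexity.
Variable R : realType.

(** Induction, multiplying by [l * x + m * y]: the defect is [l * m * (x ^+ n - y ^+ n) * (x - y)],
    and both differences have the same sign. *)
Lemma convex_expr n (l m x y : R) : 0 <= l -> 0 <= m -> l + m = 1 -> 0 <= x -> 0 <= y ->
  (l * x + m * y) ^+ n <= l * x ^+ n + m * y ^+ n.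
Proof.
move=> l0 m0 lm x0 y0; elim: n => [|n IH]; first by rewrite !expr0 !mulr1 lm.
have xy : 0 <= l * x + m * y by rewrite addr_ge0 ?mulr_ge0.
rewrite exprSr; apply: le_trans (ler_wpM2r xy IH) _; rewrite !exprSr.
have h : 0 <= (x ^+ n - y ^+ n) * (x - y).
  case: (leP x y) => hxy.
    by rewrite mulr_le0 // subr_le0 // lerXn2r.
  by rewrite mulr_ge0 // subr_ge0 ?lerXn2r // ltW.
have := mulr_ge0 (mulr_ge0 l0 m0) h.
have -> : m = 1 - l by lra.
move: (x ^+ n) (y ^+ n) => X Y; nra.
Qed.

(** Convexity at [x / l] and [y / m]; [l / l ^+ n] stands for l^(1-n). *)
Lemma expr_sum_le n (l m x y : R) : 0 < l -> 0 < m -> l + m = 1 -> 0 <= x -> 0 <= y ->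
  (x + y) ^+ n <= l / l ^+ n * x ^+ n + m / m ^+ n * y ^+ n.
Proof.
move=> l0 m0 lm x0 y0.
have := @convex_expr n l m (x / l) (y / m) (ltW l0) (ltW m0) lm.
rewrite [l * (x / l)]mulrC [m * (y / m)]mulrC !divfK ?lt0r_neq0 // !expr_div_n.
move=> H; apply: le_trans (H _ _) _; rewrite ?divr_ge0 ?(ltW l0) ?(ltW m0) //.
by rewrite [l / _ * _]mulrAC [m / _ * _]mulrAC -!mulrA.
Qed.

(** The finitely many early terms go into [C], the later ones cost [e] each. An error of small slope
    plus a constant is what a comparison of slopes tolerates. *)
Lemma cesaro (b : nat -> R) V : (forall e, 0 < e -> exists n0, forall n, (n0 <= n)%N -> `|b n - V| <= e) ->
  forall e, 0 < e -> exists C, forall n, `|\sum_(i < n) b i - V *+ n| <= e *+ n + C.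
Proof.
move=> hb e e0; have [n0 h] := hb _ e0.
exists (\sum_(i < n0) `|b i - V|) => n.
have -> : \sum_(i < n) b i - V *+ n = \sum_(i < n) (b i - V).
  by rewrite sumrB sumr_const card_ord.
apply: le_trans (ler_norm_sum _ _ _) _.
pose f n := \sum_(i < n) `|b i - V|.
have fS k : f k.+1 = f k + `|b k - V| by rewrite /f big_ord_recr.
have f0 k : f (n0 + k)%N <= e *+ k + f n0.
  elim: k => [|k IH]; first by rewrite addn0 mulr0n add0r.
  by rewrite addnS fS mulrSr addrAC lerD // h // leq_addr.
have fm k : f n <= f (n + k)%N.
  elim: k => [|k IH]; first by rewrite addn0.
  by rewrite addnS fS (le_trans IH) // lerDl.
rewrite -/(f n) -/(f n0); apply: le_trans (fm n0) _; rewrite addnC.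
exact: f0.
Qed.

End Convexity.

Section BrunnMinkowski.
Variables (R : realType) (d : nat) (h : {additive 'rV[int]_d -> R}) (S : set 'rV[int]_d).
Local Notation L := 'rV[int]_d.
Hypothesis gS : good_semigroup h S.
Variable p : nat.
Hypothesis p1 : (1 < p)%N.
Local Notation scaled := (@scaled R d p).
Local Notation excess := (@excess R d S p).
Local Notation Nexc := (@Nexc R d S p).

Definition ind (T : Type) (A : set T) (x : T) : R := `[< A x >]%:R.

Lemma sum_ind (T : choiceType) (A B : set T) : finite_set A ->
  \sum_(x <- fset_set A) ind B x = (ncard (A `&` B))%:R.
Proof.
by move=> fA; rewrite /ind -natr_sum sum_asbool.
Qed.

(** * Logarithmic sums of r^d over geometric scales *)

Section Weights.
Variables (Se : nat -> set L) (c : R) (V : R).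
Hypothesis fS : exponent_family h S p Se c.
Variables (th : R).
Hypothesis th1 : 1 < th.
Let th0 : 0 < th. Proof. exact: lt_trans th1. Qed.

(* By Abel summation, [weight M x] is th^(-d j) where j <= M is least with x in the
   excess set at scale th^j, and 0 if there is no such j. *)
Definition weight M x : R :=
  (th ^- M) ^+ d * ind (excess Se (th ^+ M)) x +
  \sum_(i < M) ((th ^- i) ^+ d - (th ^- i.+1) ^+ d) * ind (excess Se (th ^+ i)) x.

(** The weight of all lattice points together, each indicator being replaced by its count. For
    [th ^+ M = T] it stands for the sum of r(x)^d up to scale T. *)
Definition total M : R :=
  (th ^- M) ^+ d * Nexc Se (th ^+ M) +
  \sum_(i < M) ((th ^- i) ^+ d - (th ^- i.+1) ^+ d) * Nexc Se (th ^+ i).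

Lemma thX_mono i j : (i <= j)%N -> th ^+ i <= th ^+ j.
Proof. by move=> ij; rewrite ler_weXn2l // ltW. Qed.

Lemma thV_decr i j : (i <= j)%N -> (th ^- j) ^+ d <= (th ^- i) ^+ d.
Proof.
move=> ij; rewrite lerXn2r ?nnegrE ?invr_ge0 ?exprn_ge0 ?(ltW th0) //.
by rewrite lef_pV2 ?posrE ?exprn_gt0 // thX_mono.
Qed.

Lemma weight_ge0 M x : 0 <= weight M x.
Proof.
rewrite /weight /ind addr_ge0 ?mulr_ge0 ?exprn_ge0 ?invr_ge0 ?exprn_ge0 ?(ltW th0) //.
by apply: sumr_ge0 => i _; rewrite mulr_ge0 // subr_ge0 thV_decr.
Qed.

(** Excessive sets grow with the scale, so the indicators switch on once, at j, and the rest of the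
    sum telescopes from j to M. *)
Lemma weightP M x : S x ->
  (weight M x = 0 /\ scaled Se (th ^+ M) x) \/
  exists j, [/\ (j <= M)%N, weight M x = (th ^- j) ^+ d, excess Se (th ^+ j) x &
     forall i, (i < j)%N -> scaled Se (th ^+ i) x].
Proof.
move=> Sx.
have notE T : ~ excess Se T x -> scaled Se T x by move=> nE; apply: contrapT => nU; apply: nE.
have [[j0 [j0M Ej0]]|nE] := pselect (exists j, (j <= M)%N /\ excess Se (th ^+ j) x); last first.
  left; split; last by apply: notE => E; apply: nE; exists M.
  rewrite /weight /ind asboolF; last by move=> E; apply: nE; exists M.
  rewrite mulr0 add0r big1 // => i _; rewrite asboolF ?mulr0 // => E; apply: nE.
  by exists i; split => //; apply: ltnW.
right.
have ex : exists j, `[< excess Se (th ^+ j) x >] by exists j0; apply/asboolP.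
pose j := ex_minn ex; exists j.
have [Ej jm] : excess Se (th ^+ j) x /\ forall i, excess Se (th ^+ i) x -> (j <= i)%N.
  by rewrite /j; case: ex_minnP => k /asboolP Ek km; split=> // i /asboolP; apply: km.
have jM : (j <= M)%N by apply: leq_trans j0M; apply: jm.
have Ei i : (j <= i)%N -> excess Se (th ^+ i) x.
  by move=> ji; apply: excess_mono Ej; apply: thX_mono.
split=> // [|i ij]; last by apply: notE => /jm; rewrite leqNgt ij.
rewrite /weight {1}/ind asboolT; last exact: Ei.
rewrite mulr1 -(big_mkord xpredT (fun i => ((th ^- i) ^+ d - (th ^- i.+1) ^+ d) * ind (excess Se (th ^+ i)) x)).
rewrite (@big_cat_nat _ _ _ j) //= [X in _ + (X + _)]big_nat_cond big1 ?add0r; last first.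
  move=> i /andP[/andP[_ ij] _]; rewrite /ind asboolF ?mulr0 //.
  by move/jm; rewrite leqNgt ij.
rewrite (eq_big_nat _ _ (F2 := fun i => - ((th ^- i.+1) ^+ d - (th ^- i) ^+ d))).
  by rewrite sumrN telescope_sumr // opprB addrC subrK.
by move=> i /andP[ji _]; rewrite /ind asboolT ?mulr1 ?opprB //; apply: Ei.
Qed.

(** Stated for an arbitrary finite [A] because the weights of I and J will be summed over the
    excessive points of L. *)
Lemma sum_weight (A : set L) M : finite_set A ->
  \sum_(x <- fset_set A) weight M x <= total M.
Proof.
move=> fA; rewrite big_split /= -mulr_sumr exchange_big /=.
apply: lerD.
  apply: ler_wpM2l; first by rewrite exprn_ge0 // invr_ge0 exprn_ge0 // ltW.
  by rewrite sum_ind // ler_nat; apply: ncard_sub; [exact: (excess_finite gS p1 fS) | exact: subIsetr].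
apply: ler_sum => i _; rewrite -mulr_sumr; apply: ler_wpM2l.
  by rewrite subr_ge0 thV_decr.
by rewrite sum_ind // ler_nat; apply: ncard_sub; [exact: (excess_finite gS p1 fS) | exact: subIsetr].
Qed.

Lemma sum_weight_excess M :
  \sum_(x <- fset_set (excess Se (th ^+ M))) weight M x = total M.
Proof.
have fE := excess_finite gS p1 fS.
rewrite big_split /= -mulr_sumr exchange_big /= sum_ind // setIid; congr (_ + _).
apply: eq_bigr => i _; rewrite -mulr_sumr sum_ind //; congr (_ * (ncard _)%:R).
by apply: setIidr; apply: excess_mono; apply: thX_mono; apply: ltnW.
Qed.

Hypothesis hV : asym d (Nexc Se) V.

Lemma Nexc_th e : 0 < e -> exists n0, forall n, (n0 <= n)%N ->
  `|(th ^- n) ^+ d * Nexc Se (th ^+ n) - V| <= e.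
Proof.
move=> e0; have [T0 hT] := hV e0.
have [n0 hn0] : exists n0, forall n, (n0 <= n)%N -> T0 <= th ^+ n.
  have t0 : 0 < th - 1 by rewrite subr_gt0.
  exists (Num.truncn (T0 / (th - 1))).+1 => n hn.
  (* Bernoulli's inequality, which makes [th ^+ n] unbounded. *)
  have h1 : 1 + (th - 1) *+ n <= th ^+ n.
    elim: n {hn} => [|n IH]; first by rewrite mulr0n addr0 expr0.
    rewrite exprS mulrS.
    have : 0 <= (th - 1) *+ n by rewrite mulrn_wge0 // ltW.
    have := ler_wpM2l (ltW th0) IH; nra.
  apply: le_trans h1; rewrite -[T0](divfK (lt0r_neq0 t0)) -[_ *+ n]mulr_natl.
  apply: ler_wpDl => //; rewrite ler_pM2r //.
  by apply: le_trans (ltW (truncnS_gt _)) _; rewrite ler_nat.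
exists n0 => n /hn0 /hT h1.
have tp : 0 < (th ^+ n) ^+ d by rewrite !exprn_gt0.
rewrite exprVn -(ler_pM2r tp) -{2}(gtr0_norm tp) -normrM mulrBl.
by rewrite mulrAC mulVf ?lt0r_neq0 // mul1r.
Qed.

Lemma Nexc_th_bounded : exists C, forall n, `|(th ^- n) ^+ d * Nexc Se (th ^+ n)| <= C.
Proof.
pose b n := (th ^- n) ^+ d * Nexc Se (th ^+ n).
have [n0 hn0] := Nexc_th (ltr01 : 0 < (1:R)).
exists (\sum_(i < n0) `|b i| + (`|V| + 1)) => n; rewrite -/(b n).
have [nn|nn] := ltnP n n0.
  rewrite (bigD1 (Ordinal nn)) //= -!addrA lerDl !addr_ge0 //.
  exact: sumr_ge0.
have h1 : `|b n - V| <= 1 by exact: hn0.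
rewrite -[b n](subrK V); apply: le_trans (ler_normD _ _) _.
have : 0 <= \sum_(i < n0) `|b i| by apply: sumr_ge0.
lra.
Qed.

(** The coefficients factor as [(1 - th^-1 ^+ d) * (th ^- i) ^+ d], so the sum is a Cesaro sum of a
    sequence tending to V, while the last term stays bounded. Growth is linear in M, the logarithm
    of the scale. *)
Lemma total_asym e : 0 < e ->
  exists C, forall M, `|total M - (1 - th^-1 ^+ d) * V *+ M| <= e *+ M + C.
Proof.
move=> e0.
pose b n := (th ^- n) ^+ d * Nexc Se (th ^+ n).
have [C hC] := @cesaro R b V Nexc_th e e0.
have [C2 hb] := Nexc_th_bounded.
exists (C + C2) => M.
have t01 : 0 <= th^-1 ^+ d <= 1.
  by rewrite exprn_ge0 ?invr_ge0 ?(ltW th0) // exprn_ile1 ?invr_ge0 ?(ltW th0) // invf_le1 // ltW.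
have -> : total M = b M + (1 - th^-1 ^+ d) * \sum_(i < M) b i.
  rewrite /total mulr_sumr; congr (_ + _); apply: eq_bigr => i _.
  by rewrite /b mulrA; congr (_ * _); rewrite exprSr invfM exprMn mulrBl mul1r [X in _ = _ - X]mulrC.
have -> : b M + (1 - th^-1 ^+ d) * (\sum_(i < M) b i) - (1 - th^-1 ^+ d) * V *+ M =
   b M + (1 - th^-1 ^+ d) * (\sum_(i < M) b i - V *+ M).
  by rewrite mulrBr mulrnAr addrA.
apply: le_trans (ler_normD _ _) _; rewrite [X in _ + X <= _]normrM addrA [e *+ M + _ + _]addrC; apply: lerD; first exact: hb.
apply: le_trans (hC M); apply: ler_piMl => //.
by rewrite ger0_norm; lra.
Qed.

End Weights.

(** * Comparison of the families I, J and their product *)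

Variables (SI SJ SL : nat -> set L) (cI cJ cL : R).
Hypothesis fI : exponent_family h S p SI cI.
Hypothesis fJ : exponent_family h S p SJ cJ.
Hypothesis fL : exponent_family h S p SL cL.
Hypothesis IJL : forall e x y, SI e x -> SJ e y -> SL e (x + y).

(** Frobenius raises both memberships to level [e1 + e2], where they can be added. With 1/T in the
    role of r this is r_L <= r_I + r_J. *)
Lemma scaled_prod T1 T2 T x : 0 < T1 -> 0 < T2 -> 0 < T -> T1^-1 + T2^-1 <= T^-1 ->
  scaled SI T1 x -> scaled SJ T2 x -> scaled SL T x.
Proof.
move=> T10 T20 T0 TT [e1 [t1 [S1 h1]]] [e2 [t2 [S2 h2]]].
exists (e1 + e2)%N, (t1 * p ^ e2 + t2 * p ^ e1)%N; split.
  rewrite mulrnDr !mulrnA; apply: IJL; first exact: (ef_frobn fI).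
  by rewrite addnC; apply: (ef_frobn fJ).
have q1 := @expr_pgt0 R p p1 e1; have q2 := @expr_pgt0 R p p1 e2.
rewrite -ler_pdivlMr // natrD !natrM !natrX exprD.
have {}h1 : t1%:R <= p%:R ^+ e1 / T1 by rewrite ler_pdivlMr.
have {}h2 : t2%:R <= p%:R ^+ e2 / T2 by rewrite ler_pdivlMr.
move: q1 q2 h1 h2; set a := p%:R ^+ e1; set b := p%:R ^+ e2 => a0 b0 h1 h2.
apply: le_trans (_ : a * b * (T1^-1 + T2^-1) <= _); last first.
  by rewrite ler_pM2l // mulr_gt0.
have -> : a * b * (T1^-1 + T2^-1) = a / T1 * b + b / T2 * a by ring.
by apply: lerD; rewrite ler_pM2r.
Qed.

(** Convexity for r_L(x) <= r_I(x) + r_J(x), up to errors. Rounding r to powers of [th] costs the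
    factor [th ^+ d]; a point not excessive for I or J up to scale [th ^+ M] costs the
    [(th ^- M) ^+ d] term; one already excessive at scale 1 costs an indicator. *)
Lemma weight_le th M l m x : 1 < th -> 0 < l -> 0 < m -> l + m = 1 ->
  excess SL (th ^+ M) x ->
  weight SL th M x <= th ^+ d * (l / l ^+ d * weight SI th M x + m / m ^+ d * weight SJ th M x)
    + th ^+ d * (l / l ^+ d + m / m ^+ d) * (th ^- M) ^+ d
    + (ind (excess SI 1) x + ind (excess SJ 1) x).
Proof.
move=> th1 l0 m0 lm ExL.
have Sx : S x by case: ExL.
have th0 : 0 < th by exact: lt_trans th1.
have td : 0 <= th ^+ d by rewrite exprn_ge0 // ltW.
set a := l / l ^+ d; set b := m / m ^+ d.
have a0 : 0 < a by rewrite divr_gt0 // exprn_gt0.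
have b0 : 0 < b by rewrite divr_gt0 // exprn_gt0.
have wI := weight_ge0 SI th1 M x; have wJ := weight_ge0 SJ th1 M x.
have tM : 0 <= (th ^- M) ^+ d by rewrite exprn_ge0 // invr_ge0 exprn_ge0 // ltW.
have iI : 0 <= ind (excess SI 1) x by rewrite /ind.
have iJ : 0 <= ind (excess SJ 1) x by rewrite /ind.
have key : 0 <= th ^+ d * (a * weight SI th M x + b * weight SJ th M x)
    + th ^+ d * (a + b) * (th ^- M) ^+ d.
  apply: addr_ge0; apply: mulr_ge0 => //; last by rewrite mulr_ge0 ?addr_ge0 ?(ltW a0) ?(ltW b0).
  by apply: addr_ge0; apply: mulr_ge0 => //; apply: ltW.
have [[_ /(proj2 ExL) []]|[j [jM -> Ej _]]] := weightP SL th1 M Sx.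
have tj1 : (th ^- j) ^+ d <= 1.
  by have := @thV_decr th th1 0 j (leq0n j); rewrite expr0 invr1 expr1n.
(* For a point excessive for I already at scale 1, no scale in the list bounds r_I; but its weight
   for L is at most 1, so the indicator absorbs it. *)
have [E1|nE1] := pselect (excess SI 1 x).
  have : ind (excess SI 1) x = 1 by rewrite /ind asboolT.
  by move=> ->; lra.
have [E2|nE2] := pselect (excess SJ 1 x).
  have : ind (excess SJ 1) x = 1 by rewrite /ind asboolT.
  by move=> ->; lra.
(* The index k precedes the first excessive one, or is M if none occurs up to M. *)
have first Se : ~ excess Se 1 x -> exists k, scaled Se (th ^+ k) x /\
     (th ^- k.+1) ^+ d <= weight Se th M x + (th ^- M) ^+ d.
  move=> nE.
  have [[-> Us]|[[|k] [kM -> Ek Uk]]] := weightP Se th1 M Sx.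
  - by exists M; split; rewrite // add0r thV_decr.
  - by move: Ek; rewrite expr0.
  - by exists k; split; [exact: Uk | rewrite lerDl].
have [k1 [U1 w1]] := first _ nE1; have [k2 [U2 w2]] := first _ nE2.
have tX k : 0 < th ^+ k by rewrite exprn_gt0.
have tV k : 0 <= th ^- k by rewrite invr_ge0 ltW.
have lt12 : th ^- j <= th ^- k1 + th ^- k2.
  rewrite leNgt; apply/negP => /ltW lt; apply: (proj2 Ej).
  exact: scaled_prod U1 U2.
apply: (@le_trans _ _ (th ^+ d * (a * (weight SI th M x + (th ^- M) ^+ d) + b * (weight SJ th M x + (th ^- M) ^+ d)))); last by lra.
have E k : th ^- k = th * th ^- k.+1 by rewrite exprS invfM mulrA divff ?mul1r ?lt0r_neq0.
apply: (@le_trans _ _ ((th ^- k1 + th ^- k2) ^+ d)).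
  by rewrite lerXn2r ?nnegrE ?addr_ge0.
rewrite (E k1) (E k2) -mulrDr exprMn; apply: ler_wpM2l => //.
apply: le_trans (expr_sum_le d l0 m0 lm (tV _) (tV _)) _.
by apply: lerD; rewrite ler_pM2l.
Qed.

Variables (VI VJ VL : R).
Hypothesis hVI : asym d (Nexc SI) VI.
Hypothesis hVJ : asym d (Nexc SJ) VJ.
Hypothesis hVL : asym d (Nexc SL) VL.

Lemma ler_of_natmul_bound (x y C : R) : (forall n, x *+ n <= y *+ n + C) -> x <= y.
Proof.
move=> H; rewrite leNgt; apply/negP => yx.
have xy : 0 < x - y by rewrite subr_gt0.
pose n := (Num.truncn (C / (x - y))).+1.
have := H n; rewrite -lerBlDl -mulrnBl -mulr_natl -ler_pdivlMr //.
by rewrite leNgt truncnS_gt.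
Qed.

(** Sum [weight_le] over the excessive points of L and compare slopes in M: the truncation term
    stays bounded because [(th ^- M) ^+ d * Nexc SL (th ^+ M)] does, and the indicators add a
    constant. *)
Lemma volume_th_le th l m : (0 < d)%N -> 1 < th -> 0 < l -> 0 < m -> l + m = 1 ->
  VL <= th ^+ d * (l / l ^+ d * VI + m / m ^+ d * VJ).
Proof.
move=> d0 th1 l0 m0 lm.
have th0 : 0 < th by exact: lt_trans th1.
have td : 0 < th ^+ d by rewrite exprn_gt0.
set a := l / l ^+ d; set b := m / m ^+ d.
have a0 : 0 < a by rewrite divr_gt0 // exprn_gt0.
have b0 : 0 < b by rewrite divr_gt0 // exprn_gt0.
(* The factor common to all three slopes; it is positive since [0 < d] and [1 < th], and cancels at
   the end. *)
set g := 1 - th^-1 ^+ d.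
have g0 : 0 < g.
  by rewrite subr_gt0 exprn_ilt1 ?invr_ge0 ?(ltW th0) ?invf_lt1 // -lt0n.
have tot M : total SL th M <= th ^+ d * (a * total SI th M + b * total SJ th M)
    + th ^+ d * (a + b) * ((th ^- M) ^+ d * Nexc SL (th ^+ M))
    + (Nexc SI 1 + Nexc SJ 1).
  have fE := excess_finite gS p1 fL (th ^+ M).
  rewrite -(sum_weight_excess fL th1).
  set A := excess SL (th ^+ M).
  apply: (@le_trans _ _ (\sum_(x <- fset_set A) (th ^+ d * (a * weight SI th M x + b * weight SJ th M x)
    + th ^+ d * (a + b) * (th ^- M) ^+ d
    + (ind (excess SI 1) x + ind (excess SJ 1) x)))).
    rewrite big_seq [leRHS]big_seq; apply: ler_sum => x.
    by rewrite in_fset_set // inE => Ax; apply: weight_le.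
  rewrite !big_split /= -mulr_sumr big_split /= -!mulr_sumr.
  have hI := sum_weight fI th1 M fE; have hJ := sum_weight fJ th1 M fE.
  apply: lerD; last first.
    by rewrite !sum_ind //; apply: lerD; rewrite ler_nat; apply: ncard_sub;
      [exact: (excess_finite gS p1 fI) | exact: subIsetr
      | exact: (excess_finite gS p1 fJ) | exact: subIsetr].
  apply: lerD.
    by rewrite ler_pM2l //; apply: lerD; rewrite ler_pM2l.
  rewrite big_const_seq count_predT iter_addr_0 /Nexc /ncard -/A.
  by rewrite -[in leLHS]mulr_natr -mulrA.
have e1 e : 0 < e -> g * VL - e <= th ^+ d * (a * (g * VI + e) + b * (g * VJ + e)).
  move=> e0.
  have [CI HI] := total_asym th1 hVI e0; have [CJ HJ] := total_asym th1 hVJ e0.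
  have [CL HL] := total_asym th1 hVL e0.
  have [C HC] := Nexc_th_bounded th1 hVL.
  apply: (@ler_of_natmul_bound _ _ (CL + th ^+ d * (a * CI + b * CJ) +
    th ^+ d * (a + b) * C + (Nexc SI 1 + Nexc SJ 1))) => n.
  have := HL n; rewrite ler_norml => /andP[hL _].
  have := HI n; rewrite ler_norml => /andP[_ hI].
  have := HJ n; rewrite ler_norml => /andP[_ hJ].
  have hC := le_trans (ler_norm _) (HC n).
  have {}hI : a * total SI th n <= a * ((g * VI) *+ n + e *+ n + CI).
    by rewrite ler_pM2l // -/g in hI *; lra.
  have {}hJ : b * total SJ th n <= b * ((g * VJ) *+ n + e *+ n + CJ).
    by rewrite ler_pM2l // -/g in hJ *; lra.
  have hIJ : th ^+ d * (a * total SI th n + b * total SJ th n) <=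
      th ^+ d * (a * ((g * VI) *+ n + e *+ n + CI) + b * ((g * VJ) *+ n + e *+ n + CJ)).
    by rewrite ler_pM2l //; apply: lerD.
  have {}hC : th ^+ d * (a + b) * ((th ^- n) ^+ d * Nexc SL (th ^+ n)) <= th ^+ d * (a + b) * C.
    by apply: ler_wpM2l => //; rewrite mulr_ge0 ?addr_ge0 // ltW.
  have hT := tot n.
  have -> : (g * VL - e) *+ n = (g * VL) *+ n - e *+ n by rewrite mulrnBl.
  have -> : (th ^+ d * (a * (g * VI + e) + b * (g * VJ + e))) *+ n =
    th ^+ d * (a * ((g * VI) *+ n + e *+ n) + b * ((g * VJ) *+ n + e *+ n)).
    by rewrite -[LHS]mulrnAr mulrnDl -[(a * _) *+ n]mulrnAr -[(b * _) *+ n]mulrnAr !mulrnDl.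
  move: hL; rewrite -/g => hL; lra.
rewrite -(ler_pM2l g0); apply/ler_addgt0Pr => e e0.
(* With [e / k] in place of [e], the errors of both sides add up to [e]. *)
pose k := 1 + th ^+ d * (a + b).
have k0 : 0 < k by rewrite /k ltr_wpDr // mulr_ge0 ?addr_ge0 ?ltW.
have := e1 (e / k) (divr_gt0 e0 k0).
have -> : th ^+ d * (a * (g * VI + e / k) + b * (g * VJ + e / k)) =
  g * (th ^+ d * (a * VI + b * VJ)) + (k - 1) * (e / k) by rewrite /k; ring.
have -> : (k - 1) * (e / k) = e - e / k by field; rewrite lt0r_neq0.
lra.
Qed.

(** Let [th] tend to 1. The choice [(T0 + 1) / T0] lets [expr_shift] provide the continuity of the
    d-th power at 1. *)
Lemma volume_le l m : (0 < d)%N -> 0 < l -> 0 < m -> l + m = 1 ->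
  VL <= l / l ^+ d * VI + m / m ^+ d * VJ.
Proof.
move=> d0 l0 m0 lm.
set W := _ + _; rewrite leNgt; apply/negP => WV.
pose e := (VL - W) / (`|W| + 1).
have w0 : 0 < `|W| + 1 by rewrite ltr_wpDl.
have e0 : 0 < e by rewrite divr_gt0 // subr_gt0.
have [T0 T01 hT] := expr_shift d 1 e0.
have T0p : 0 < T0 by exact: lt_le_trans T01.
have th1 : 1 < (T0 + 1) / T0 by rewrite ltr_pdivlMr // mul1r ltrDl.
have := volume_th_le d0 th1 l0 m0 lm; rewrite -/W; apply/negP; rewrite -ltNge.
have Td : 0 < T0 ^+ d by rewrite exprn_gt0.
have h1 : `|((T0 + 1) / T0) ^+ d - 1| <= e.
  have := hT _ (lexx T0); rewrite -ler_pdivrMr // -{2}(gtr0_norm Td) -normf_div.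
  by rewrite mulrBl divff ?lt0r_neq0 // -expr_div_n.
set y := (_ / _) ^+ d in h1 *.
have -> : y * W = W + (y - 1) * W by ring.
have h2 : `|(y - 1) * W| <= e * `|W| by rewrite normrM ler_wpM2r.
have h3 : e * `|W| < VL - W.
  by rewrite /e mulrAC ltr_pdivrMr // ltr_pM2l ?subr_gt0 // ltrDl.
have := le_lt_trans (le_trans (ler_norm _) h2) h3; lra.
Qed.

End BrunnMinkowski.

(** * Colengths and graded ranks *)

Section Ideals.
Variable A : comNzRingType.
Implicit Types (I M : A -> Prop).

Lemma ideal0 I : is_ideal I -> I 0. Proof. by case. Qed.
Lemma idealD I x y : is_ideal I -> I x -> I y -> I (x + y). Proof. by case=> _ [h _]; apply: h. Qed.
Lemma idealMl I r x : is_ideal I -> I x -> I (r * x). Proof. by case=> _ [_ h]; apply: h. Qed.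
Lemma idealMr I r x : is_ideal I -> I x -> I (x * r).
Proof. by rewrite mulrC; apply: idealMl. Qed.
Lemma idealN I x : is_ideal I -> I x -> I (- x).
Proof. by move=> hI Ix; rewrite -mulN1r; apply: idealMl. Qed.
Lemma idealB I x y : is_ideal I -> I x -> I y -> I (x - y).
Proof. by move=> hI Ix Iy; apply: idealD => //; apply: idealN. Qed.
Lemma ideal_sum I (J : Type) (s : seq J) (f : J -> A) :
  is_ideal I -> (forall i, I (f i)) -> I (\sum_(i <- s) f i).
Proof.
move=> hI hf; elim/big_rec: _ => [|i x _]; first exact: ideal0.
by apply: idealD.
Qed.

Lemma gen_ideal_ideal (S : A -> Prop) : is_ideal (gen_ideal S).
Proof.
split; first by move=> J hJ _; apply: ideal0.
split=> [x y hx hy J hJ SJ|r x hx J hJ SJ]; first by apply: idealD => //; [apply: hx | apply: hy].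
by apply: idealMl => //; apply: hx.
Qed.

Lemma gen_ideal_sub (S : A -> Prop) x : S x -> gen_ideal S x.
Proof. by move=> Sx J _; apply. Qed.

(** Maximality applied to M + (c). Working with inverses modulo M avoids forming the field A/M. *)
Lemma maximal_inverse M c : is_maximal_ideal M -> ~ M c -> exists r, M (1 - r * c).
Proof.
move=> [hM [_ mM]] nMc.
pose J := [set x : A | exists a r, M a /\ x = a + r * c].
have hJ : is_ideal J.
  split; first by exists 0, 0; split; [exact: ideal0 | rewrite mul0r addr0].
  split=> [x y [a [r [Ma ->]]] [b [s [Mb ->]]]|r x [a [s [Ma ->]]]].
    by exists (a + b), (r + s); split; [exact: idealD | rewrite mulrDl addrACA].
  by exists (r * a), (r * s); split; [exact: idealMl | rewrite mulrDr mulrA].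
have [|[a [r [Ma E]]]|JM] := mM J hJ.
- by move=> x Mx; exists x, 0; rewrite mul0r addr0.
- by exists r; rewrite E addrK.
case: nMc; apply: JM; exists 0, 1; split; [exact: ideal0 | by rewrite mul1r add0r].
Qed.

(* Gaussian elimination over the field A/M. *)
Lemma maximal_dependence M k n (C : 'I_n -> nat -> A) : is_maximal_ideal M -> (k < n)%N ->
  exists b : 'I_n -> A, (exists i, ~ M (b i)) /\
    forall j, (j < k)%N -> M (\sum_i b i * C i j).
Proof.
move=> mM; have [hM [M1 _]] := mM.
elim: k n C => [|k IH] [|n] C //.
  by move=> _; exists (fun=> 1); split=> //; exists ord0.
rewrite ltnS => kn.
have [allM|/existsNP [i0 nM]] := pselect (forall i, M (C i k)).
  have [b [hb hC]] := IH _ C (ltnW kn : (k < n.+1)%N).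
  exists b; split=> // j; rewrite ltnS leq_eqVlt => /orP[/eqP ->|]; last exact: hC.
  by apply: ideal_sum => // i; apply: idealMl.
have [r hr] := maximal_inverse mM nM.
(* Subtract the multiple of row [i0] that makes column [k] vanish modulo M. *)
pose C' i j := C (lift i0 i) j - C (lift i0 i) k * r * C i0 j.
have [b [[i1 hb] hC]] := IH _ C' kn.
(* The coefficient of row [i0] makes up for these subtractions, so both combinations agree. *)
pose b' i := if unlift i0 i is Some i' then b i' else - \sum_i' b i' * C (lift i0 i') k * r.
exists b'; split; first by exists (lift i0 i1); rewrite /b' liftK.
move=> j; rewrite ltnS => jk.
have -> : \sum_i b' i * C i j = \sum_i b i * C' i j.
  rewrite (bigD1_ord i0) //= {1}/b' unlift_none mulNr mulr_suml -sumrN -big_split /=.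
  apply: eq_bigr => i _; rewrite /b' liftK /C' mulrBr addrC; congr (_ - _).
  by rewrite !mulrA.
move: jk; rewrite leq_eqVlt => /orP[/eqP ->|]; last exact: hC.
apply: ideal_sum => // i; apply: idealMl => //.
have -> : C' i k = C (lift i0 i) k * (1 - r * C i0 k) by rewrite /C' mulrBr mulr1 mulrA.
exact: idealMl.
Qed.

End Ideals.

Lemma frac_repr (D : idomainType) (x : {fraction D}) : exists a b : D, b != 0 /\
   x = FracField.tofrac a / FracField.tofrac b.
Proof.
elim/quotW: x => r; exists \n_r, \d_r; split; first exact: denom_ratioP.
apply: (canRL (mulfK _)); first by rewrite tofrac_eq0 denom_ratioP.
unlock FracField.tofrac; rewrite -[LHS]FracField.pi_mul; apply/eqmodP => /=.
rewrite FracField.equivfE /FracField.mulf !numden_Ratio ?oner_neq0 ?mulf_neq0 ?denom_ratioP //.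
all: rewrite ?oner_eq0 //.
by rewrite !mulr1 mulrC.
Qed.

Section Valued.
Variables (D : idomainType) (R : realType) (d : nat).
Local Notation F := {fraction D}.
Local Notation L := 'rV[int]_d.
Local Notation "x %:F" := (@FracField.tofrac D x).
Variables (v : F -> L) (h : {additive L -> R}) (m : D -> Prop).
Local Notation w x := (h (v x)).

(** The premise gives 0 an infinite value, whatever [v 0] is. *)
Definition val_ge (t : R) (x : F) := x != 0 -> t <= w x.
Definition val_gt (t : R) (x : F) := x != 0 -> t < w x.

(** Conditions (i) and (iii), with the order carried by [h]. Condition (ii) enters through the
    growth of the value semigroup, (iv) through the depth of the ideals. *)
Record ok_valuation := OkValuation {
  okv_inj : injective h;
  okvM : forall x y, x != 0 -> y != 0 -> v (x * y) = v x + v y;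
  okvD : forall x y, x != 0 -> y != 0 -> x + y != 0 -> w x <= w (x + y) \/ w y <= w (x + y);
  okv_ge0 : forall r : D, val_ge 0 r%:F;
  okv_max : is_maximal_ideal m;
  okv_m : forall r : D, m r <-> val_gt 0 r%:F;
  okv_res : exists s : seq F, (forall x, x \in s -> val_ge 0 x) /\
    forall x, val_ge 0 x -> exists c : seq D, size c = size s /\
      val_gt 0 (x - \sum_(pr <- zip c s) (pr.1)%:F * pr.2) }.

Hypothesis ok : ok_valuation.
Let mM := okv_max ok.

Lemma v1 : v 1 = 0.
Proof.
have := okvM ok (oner_neq0 F) (oner_neq0 F); rewrite mulr1 => /eqP.
by rewrite -[X in X == _]addr0 => /eqP /addrI.
Qed.

Lemma wN x : w (- x) = w x.
Proof.
have [->|x0] := eqVneq x 0; first by rewrite oppr0.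
have n1 : (-1 : F) != 0 by rewrite oppr_eq0 oner_neq0.
have E : v (-1) + v (-1) = 0 by rewrite -(okvM ok n1 n1) mulrNN mulr1 v1.
have E2 : h (v (-1)) = 0.
  by have := congr1 h E; rewrite raddfD raddf0; lra.
by rewrite -mulN1r (okvM ok) // raddfD E2 add0r.
Qed.

Lemma wV x : x != 0 -> w x^-1 = - w x.
Proof.
move=> x0; have := v1; rewrite -(mulfV x0) (okvM ok) ?invr_neq0 // => /(congr1 h).
by rewrite raddfD raddf0 => /eqP; rewrite addrC addr_eq0 => /eqP.
Qed.

Lemma val_geD t x y : val_ge t x -> val_ge t y -> val_ge t (x + y).
Proof.
have [->|x0] := eqVneq x 0; first by rewrite add0r.
have [->|y0] := eqVneq y 0; first by rewrite addr0.
move=> /(_ x0) hx /(_ y0) hy xy0.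
by have [] := okvD ok x0 y0 xy0; apply: le_trans.
Qed.

Lemma val_gtD t x y : val_gt t x -> val_gt t y -> val_gt t (x + y).
Proof.
have [->|x0] := eqVneq x 0; first by rewrite add0r.
have [->|y0] := eqVneq y 0; first by rewrite addr0.
move=> /(_ x0) hx /(_ y0) hy xy0.
by have [] := okvD ok x0 y0 xy0; apply: lt_le_trans.
Qed.

Lemma val_gtN t x : val_gt t x -> val_gt t (- x).
Proof. by move=> hx; rewrite /val_gt oppr_eq0 wN. Qed.

Lemma val_gtB t x y : val_gt t x -> val_gt t y -> val_gt t (x - y).
Proof. by move=> hx hy; apply: val_gtD => //; apply: val_gtN. Qed.

Lemma val_gt_ge t x : val_gt t x -> val_ge t x.
Proof. by move=> hx /hx /ltW. Qed.

Lemma val_gt0 t : val_gt t 0. Proof. by rewrite /val_gt eqxx. Qed.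

Lemma val_geM s t x y : val_ge s x -> val_ge t y -> val_ge (s + t) (x * y).
Proof.
move=> hx hy; rewrite /val_ge mulf_eq0 negb_or => /andP[x0 y0].
by rewrite (okvM ok) // raddfD lerD ?hx ?hy.
Qed.

Lemma val_gtM s t x y : val_gt s x -> val_ge t y -> val_gt (s + t) (x * y).
Proof.
move=> hx hy; rewrite /val_gt mulf_eq0 negb_or => /andP[x0 y0].
by rewrite (okvM ok) // raddfD ltr_leD ?hx ?hy.
Qed.

Lemma val_gt_scale t (r : D) x : val_gt t x -> val_gt t (r%:F * x).
Proof.
by move=> hx; rewrite mulrC -[t]addr0; apply: val_gtM => //; apply: (okv_ge0 ok).
Qed.

Lemma val_ge_scale t (r : D) x : val_ge t x -> val_ge t (r%:F * x).
Proof. by move=> hx; rewrite -[t]add0r; apply: val_geM => //; apply: (okv_ge0 ok). Qed.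

Lemma val_gt_scalem t (r : D) x : m r -> val_ge t x -> val_gt t (r%:F * x).
Proof. by move=> /(okv_m ok) mr hx; rewrite -[t]add0r; apply: val_gtM. Qed.

Lemma val_gt_sum t (I : Type) (s : seq I) (f : I -> F) :
  (forall i, val_gt t (f i)) -> val_gt t (\sum_(i <- s) f i).
Proof. by move=> hf; elim/big_rec: _ => [|i x _]; [exact: val_gt0 | apply: val_gtD]. Qed.

(* Linear independence over D/m of the leading terms in the graded piece of height t. *)
Definition indep t n (f : 'I_n -> F) : Prop := (forall i, val_ge t (f i)) /\
  forall c : 'I_n -> D, val_gt t (\sum_i (c i)%:F * f i) -> forall i, m (c i).

Definition has_indep (M : F -> Prop) t n := exists f : 'I_n -> F, (forall i, M (f i)) /\ indep t f.

Lemma indep_not_gt t n (f : 'I_n -> F) i : indep t f -> ~ val_gt t (f i).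
Proof.
move=> [_ hf] gt; have [_ [m1 _]] := mM; apply: m1.
have := hf (fun j => (j == i)%:R); rewrite (bigD1 i) //= big1 ?addr0; last first.
  by move=> j /negbTE ->; rewrite rmorph0 mul0r.
by rewrite eqxx rmorph1 mul1r => /(_ gt i); rewrite eqxx.
Qed.

Lemma indep_val t n (f : 'I_n -> F) i : indep t f -> f i != 0 /\ w (f i) = t.
Proof.
move=> hf; have ngt := @indep_not_gt _ _ _ i hf.
have [f0|f0] := eqVneq (f i) 0; first by case: ngt; rewrite f0; apply: val_gt0.
split=> //; apply/eqP; rewrite eq_le (proj1 hf) // andbT leNgt.
by apply/negP => lt; apply: ngt.
Qed.

Lemma indep_close t n (f g : 'I_n -> F) : indep t f -> (forall i, val_gt t (f i - g i)) ->
  indep t g.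
Proof.
move=> [hf1 hf2] fg; split=> [i|c hc].
  have -> : g i = f i - (f i - g i) by rewrite opprB addrC subrK.
  by apply: val_geD => //; apply/val_gt_ge/val_gtN.
apply: hf2.
have -> : \sum_i (c i)%:F * f i = \sum_i (c i)%:F * g i + \sum_i (c i)%:F * (f i - g i).
  by rewrite -big_split /=; apply: eq_bigr => i _; rewrite -mulrDr addrC subrK.
by apply: val_gtD => //; apply: val_gt_sum => i; apply: val_gt_scale.
Qed.

Lemma indep_scale t s n (f : 'I_n -> F) x : x != 0 -> w x = s -> indep t f ->
  indep (s + t) (fun i => x * f i).
Proof.
move=> x0 wx [hf1 hf2]; split=> [i|c hc].
  by apply: val_geM => //; rewrite /val_ge wx.
apply: hf2 => S0; rewrite -(ltrD2l s) -[X in X + w _]wx -raddfD -(okvM ok) //.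
have E : \sum_i (c i)%:F * (x * f i) = x * (\sum_i (c i)%:F * f i).
  by rewrite mulr_sumr; apply: eq_bigr => i _; rewrite mulrCA.
by rewrite -E; apply: hc; rewrite E mulf_neq0.
Qed.

(** Divide by one member to reach height 0, expand along the finite spanning set of k_V, and
    eliminate among more than [size s] coefficient rows. *)
Lemma indep_bounded : exists N, forall t n (f : 'I_n -> F), indep t f -> (n <= N)%N.
Proof.
have [s [s0 hs]] := okv_res ok; exists (size s) => t n f hf.
rewrite leqNgt; apply/negP => sn.
have n0 : (0 < n)%N by apply: leq_ltn_trans sn.
have [f0 wf0] := @indep_val _ _ _ (Ordinal n0) hf.
set y := f (Ordinal n0) in f0 wf0.
have wy : w y^-1 = - t by rewrite wV // wf0.
have y'0 : y^-1 != 0 by rewrite invr_neq0.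
have := indep_scale y'0 wy hf; rewrite addNr => {f0 wf0} [[g1 g2]].
have /choice [c hc] : forall i, exists c : seq D, size c = size s /\
    val_gt 0 (y^-1 * f i - \sum_(pr <- zip c s) (pr.1)%:F * pr.2).
  by move=> i; apply: hs; apply: g1.
have [b [[i1 nb] hb]] := maximal_dependence (fun i j => (c i)`_j) mM sn.
apply: nb; apply: g2.
have E i : \sum_(pr <- zip (c i) s) (pr.1)%:F * pr.2 = \sum_(j < size s) ((c i)`_j)%:F * s`_j.
  have [szc _] := hc i.
  rewrite (big_nth (0, 0)) size_zip szc minnn big_mkord; apply: eq_bigr => j _.
  by rewrite nth_zip.
have -> : \sum_i (b i)%:F * (y^-1 * f i) =
    \sum_i (b i)%:F * (y^-1 * f i - \sum_(j < size s) ((c i)`_j)%:F * s`_j) +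
    \sum_(j < size s) (\sum_i b i * (c i)`_j)%:F * s`_j.
  have -> : \sum_(j < size s) (\sum_i b i * (c i)`_j)%:F * s`_j =
     \sum_i (b i)%:F * \sum_(j < size s) ((c i)`_j)%:F * s`_j.
    under [RHS]eq_bigr do rewrite mulr_sumr.
    rewrite exchange_big /=; apply: eq_bigr => j _; rewrite rmorph_sum mulr_suml.
    by apply: eq_bigr => i _; rewrite rmorphM mulrA.
  by rewrite -big_split /=; apply: eq_bigr => i _; rewrite -mulrDr subrK.
apply: val_gtD.
  by apply: val_gt_sum => i; apply: val_gt_scale; rewrite -E; case: (hc i).
apply: val_gt_sum => j; apply: val_gt_scalem; first exact: hb.
by apply: s0; apply: mem_nth.
Qed.

Lemma rank_exists (M : F -> Prop) t :
  exists r, has_indep M t r /\ forall n, has_indep M t n -> (n <= r)%N.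
Proof.
have [N hN] := indep_bounded.
have ex : exists n, `[< has_indep M t n >].
  exists 0%N; apply/asboolP; exists (fun=> 0); split; first by case.
  by split=> [|c _] [].
have bd n : `[< has_indep M t n >] -> (n <= N)%N.
  by move=> /asboolP [f [_ /hN]].
exists (ex_maxn ex bd); case: ex_maxnP => r /asboolP hr mr; split=> // n hn.
by apply: mr; apply/asboolP.
Qed.

(** For a D-submodule M this is the dimension over D/m of its part of height at least t modulo its
    part of larger height. *)
Definition rank M t : nat := projT1 (cid (rank_exists M t)).

Lemma rankP M t : has_indep M t (rank M t).
Proof. by rewrite /rank; case: cid => r []. Qed.

Lemma leq_rank M t n : has_indep M t n -> (n <= rank M t)%N.
Proof. by rewrite /rank; case: cid => r [hr0 hr] hn; apply: hr. Qed.

Lemma rank_sub (M M' : F -> Prop) t : (forall x, M x -> M' x) -> (rank M t <= rank M' t)%N.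
Proof.
by move=> MM; apply: leq_rank; have [f [Mf hf]] := rankP M t; exists f; split=> // i; apply: MM.
Qed.

(* This is [k_V : k]. *)
Definition res_degree : nat := rank (fun=> True) 0.

Lemma rank_le_res M t : (rank M t <= res_degree)%N.
Proof.
have [f [Mf hf]] := rankP M t; apply: leq_rank.
move: (rank M t) f Mf hf => [|n] f Mf hf.
  by exists f; split=> //; split=> [|c _] [].
have [f0 wf0] := @indep_val _ _ _ ord0 hf.
exists (fun i => (f ord0)^-1 * f i); split=> //.
have y'0 : (f ord0)^-1 != 0 by rewrite invr_neq0.
have wy : w (f ord0)^-1 = - t by rewrite wV // wf0.
by have := indep_scale y'0 wy hf; rewrite addNr.
Qed.

Definition idl (I : D -> Prop) : F -> Prop := fun x => exists r, I r /\ x = r%:F.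

Definition values (I : D -> Prop) : set L := [set u | exists r, [/\ I r, r != 0 & v r%:F = u]].

Lemma rank_values I t u : h u = t -> ~ values I u -> rank (idl I) t = 0%N.
Proof.
move=> hu nu; have [f [Mf hf]] := rankP (idl I) t.
move: (rank _ _) f Mf hf => [//|n] f Mf hf; case: nu.
have [f0 wf] := @indep_val _ _ _ ord0 hf; have [r [Ir E]] := Mf ord0.
exists r; split=> //; first by move: f0; rewrite E tofrac_eq0.
by apply: (okv_inj ok); rewrite -E wf hu.
Qed.

Lemma common_denominator n (f : 'I_n -> F) :
  exists2 g : D, g != 0 & forall i, exists r : D, g%:F * f i = r%:F.
Proof.
elim: n f => [|n IH] f; first by exists 1; [exact: oner_neq0 | case].
have [g g0 hg] := IH (fun i => f (lift ord0 i)).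
have [a [b [b0 E]]] := frac_repr (f ord0).
exists (b * g); first by rewrite mulf_neq0.
move=> i; have [j ->|->] := unliftP ord0 i.
  have [r hr] := hg j; exists (b * r); by rewrite !rmorphM -mulrA hr.
exists (g * a); rewrite E !rmorphM [b%:F * _]mulrC -mulrA; congr (_ * _).
by rewrite mulrCA divff ?mulr1 // tofrac_eq0.
Qed.

(** Let g be a common denominator of a family realising [res_degree] at height 0: multiplying the
    family by [r * g], r in I, lands in I. Since g does not depend on I, full rank holds on one
    fixed translate of the values of any ideal, and only a slab is lost. *)
Lemma rank_full : exists2 g : D, g != 0 & forall I, is_ideal I -> forall u, values I u ->
  rank (idl I) (h u + w g%:F) = res_degree.
Proof.
have [f [_ hf]] := rankP (fun=> True) 0.
have [g g0 hg] := common_denominator f.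
exists g => // I hI u [r [Ir r0 <-]]; apply/eqP; rewrite eqn_leq rank_le_res.
apply: leq_rank; exists (fun i => (r * g)%:F * f i); split=> [i|].
  have [s hs] := hg i; exists (r * s); split; first exact: idealMr.
  by rewrite !rmorphM -mulrA hs.
have rg0 : r * g != 0 by rewrite mulf_neq0.
have := @indep_scale 0 (h (v r%:F) + h (v g%:F)) _ f (r * g)%:F.
rewrite addr0; apply=> //; first by rewrite tofrac_eq0.
by rewrite rmorphM (okvM ok) ?tofrac_eq0 // raddfD.
Qed.

Lemma sum_famF (I : D -> Prop) n (f : 'I_n -> F) (c : 'I_n -> D) : is_ideal I ->
  (forall i, idl I (f i)) -> idl I (\sum_i (c i)%:F * f i).
Proof.
move=> hI /choice [r hr]; exists (\sum_i c i * r i); split.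
  by apply: ideal_sum => // i; apply: idealMl => //; case: (hr i).
by rewrite rmorph_sum; apply: eq_bigr => i _; rewrite rmorphM; case: (hr i) => _ ->.
Qed.

(** Adjoin x to a maximal family for I. If a combination gains height while the coefficient of x is
    invertible modulo m, it lies in J above all of [J \ I], hence in I, and solving for x puts x in
    I. *)
Lemma rank_grow I J x : is_ideal I -> is_ideal J -> isubset I J -> J x -> ~ I x ->
  (forall y, J y -> ~ I y -> w y%:F <= w x%:F) ->
  (rank (idl I) (w x%:F) < rank (idl J) (w x%:F))%N.
Proof.
move=> hI hJ IJ Jx nIx mx; set t := w x%:F.
have x0 : x%:F != 0 by rewrite tofrac_eq0; apply/eqP => E; apply: nIx; rewrite E; apply: ideal0.
have gtI y : J y -> val_gt t y%:F -> I y.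
  move=> Jy gt; apply: contrapT => nI; have := mx _ Jy nI; rewrite leNgt => /negP; apply.
  apply: gt; rewrite tofrac_eq0; apply/eqP => E; apply: nI; rewrite E; exact: ideal0.
have [f [If hf]] := rankP (idl I) t.
set n := rank (idl I) t in f If hf *.
pose f' i := if unlift ord0 i is Some j then f j else x%:F : F.
apply: leq_rank; exists (f' : 'I_n.+1 -> F); split.
  move=> i; rewrite /f'; case: unlift => [j|]; last by exists x.
  by have [r [Ir ->]] := If j; exists r; split=> //; apply: IJ.
split.
  move=> i; rewrite /f'; case: unlift => [j|]; last by move=> _; apply: lexx.
  exact: (proj1 hf).
move=> c; rewrite big_ord_recl /f' unlift_none.
under eq_bigr do rewrite liftK.
set s := \sum_i _ => gt.
have [s' [Is' Es]] : idl I s by exact: sum_famF.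
have m0 : m (c ord0).
  apply: contrapT => /(maximal_inverse mM) [r mr]; apply: nIx.
  have Jc : J (c ord0 * x + s') by apply: idealD => //; [exact: idealMl | exact: IJ].
  have Ic : I (c ord0 * x + s') by apply: gtI => //; rewrite tofracD tofracM -Es.
  have Im : I ((1 - r * c ord0) * x).
    apply: gtI; first exact: idealMl.
    by rewrite rmorphM; apply: val_gt_scalem => // _; apply: lexx.
  have -> : x = (1 - r * c ord0) * x + r * (c ord0 * x + s') - r * s' by ring.
  by apply: idealB => //; [apply: idealD => //|]; apply: idealMl.
move=> i; have [j ->|->] := unliftP ord0 i; last exact: m0.
apply: (proj2 hf (fun j => c (lift ord0 j))).
rewrite -/s -[s](addKr ((c ord0)%:F * x%:F)) addrC; apply: val_gtB => //.
by apply: val_gt_scalem => // _; apply: lexx.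
Qed.

Section AddElement.
Variables (I : D -> Prop) (x : D).
Hypotheses (hI : is_ideal I) (nIx : ~ I x).
Hypothesis mx : forall y, ~ I y -> w y%:F <= w x%:F.

Definition add_elt : D -> Prop := fun y => exists k r, I k /\ y = k + r * x.

Lemma add_elt_ideal : is_ideal add_elt.
Proof.
split; first by exists 0, 0; split; [exact: ideal0 | rewrite mul0r addr0].
split=> [y z [a [r [Ma ->]]] [b [s [Mb ->]]]|r y [a [s [Ma ->]]]].
  by exists (a + b), (r + s); split; [exact: idealD | rewrite mulrDl addrACA].
by exists (r * a), (r * s); split; [exact: idealMl | rewrite mulrDr mulrA].
Qed.

Lemma sub_add_elt : isubset I add_elt.
Proof. by move=> y Iy; exists y, 0; rewrite mul0r addr0. Qed.

Lemma mem_add_elt : add_elt x.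
Proof. by exists 0, 1; split; [exact: ideal0 | rewrite mul1r add0r]. Qed.

Let gtI y : val_gt (w x%:F) y%:F -> I y.
Proof.
move=> gt; apply: contrapT => nI; have := mx nI; rewrite leNgt => /negP; apply.
apply: gt; rewrite tofrac_eq0; apply/eqP => E; apply: nI; rewrite E; exact: ideal0.
Qed.

Let mxI r : m r -> I (r * x).
Proof. by move=> mr; apply: gtI; rewrite rmorphM; apply: val_gt_scalem => // _; apply: lexx. Qed.

(** Below the height of x, multiples of x do not affect leading terms; above it, everything already
    lies in I by maximality of x. *)
Lemma rank_add_elt_neq t : t != w x%:F -> (rank (idl add_elt) t <= rank (idl I) t)%N.
Proof.
move=> tx; have [f [Mf hf]] := rankP (idl add_elt) t; apply: leq_rank.
have [lt|gt|E] := ltgtP t (w x%:F); last by rewrite E eqxx in tx.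
  have /choice [k hk] : forall i, exists k : D, I k /\ val_gt t (f i - k%:F).
    move=> i; have [y [[k [r [Ik ->]]] ->]] := Mf i; exists k; split=> //.
    rewrite rmorphD addrC addKr rmorphM; apply: val_gt_scale => _; exact: lt.
  exists (fun i => (k i)%:F); split; first by move=> i; exists (k i); case: (hk i).
  by apply: indep_close hf _ => i; case: (hk i).
exists f; split=> // i; have [y [_ E]] := Mf i; exists y; split=> //; apply: gtI => y0.
by apply: lt_le_trans gt _; rewrite -E; apply: (proj1 hf); rewrite E.
Qed.

(** As m x lies in I, only the coefficient of x modulo m counts. A member with invertible
    coefficient serves as pivot, and clearing the others against it leaves a family in I with one
    member fewer. *)
Lemma rank_add_elt_eq : (rank (idl add_elt) (w x%:F) <= (rank (idl I) (w x%:F)).+1)%N.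
Proof.
set t := w x%:F; have [f [Mf hf]] := rankP (idl add_elt) t.
have /choice [kr hkr] : forall i, exists kr : D * D, I kr.1 /\ f i = (kr.1 + kr.2 * x)%:F.
  by move=> i; have [y [[k [r [Ik ->]]] ->]] := Mf i; exists (k, r).
have [allm|/existsNP [i0 ni0]] := pselect (forall i, m (kr i).2).
  apply: leqW; apply: leq_rank; exists f; split=> // i.
  have [Ik E] := hkr i; exists ((kr i).1 + (kr i).2 * x); split=> //.
  by apply: idealD => //; apply: mxI.
have [r' mr'] := maximal_inverse mM ni0.
move: (rank (idl add_elt) t) f Mf hf kr hkr i0 ni0 mr' => [|n] f Mf hf kr hkr i0 ni0 mr'.
  by case: (i0) => [].
rewrite ltnS; apply: leq_rank.
pose c i := (kr (lift i0 i)).2 * r'.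
exists (fun i => f (lift i0 i) - (c i)%:F * f i0); split.
  move=> i; have [I1 ->] := hkr (lift i0 i); have [I2 ->] := hkr i0.
  exists ((kr (lift i0 i)).1 - c i * (kr i0).1 + (kr (lift i0 i)).2 * ((1 - r' * (kr i0).2) * x)).
  split; last by rewrite -rmorphM -rmorphB; congr (_%:F); rewrite /c; ring.
  by apply: idealD => //; [apply: idealB => //; apply: idealMl | apply: idealMl => //; apply: mxI].
split.
  move=> i; rewrite -mulNr -rmorphN; apply: val_geD; first exact: (proj1 hf).
  by apply: val_ge_scale; apply: (proj1 hf).
move=> b gt i.
pose b' j := if unlift i0 j is Some j' then b j' else - \sum_j' b j' * c j'.
have := proj2 hf b'; rewrite (bigD1_ord i0) //= {1}/b' unlift_none.
have -> : (- \sum_j' b j' * c j')%:F * f i0 + \sum_(i1 < n) (b' (lift i0 i1))%:F * f (lift i0 i1)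
   = \sum_i (b i)%:F * (f (lift i0 i) - (c i)%:F * f i0).
  rewrite rmorphN rmorph_sum mulNr mulr_suml -sumrN -big_split /=; apply: eq_bigr => j _.
  by rewrite /b' liftK mulrBr addrC rmorphM mulrA.
by move=> /(_ gt (lift i0 i)); rewrite /b' liftK.
Qed.

End AddElement.

(** * Colength as a difference of sums of graded ranks *)

Section Colength.
Variable X : R.
Local Notation S := (values (fun=> True)).
Local Notation below := (below h S).
Hypothesis fin : forall Y, finite_set (below Y).

Definition rank_sum (I : D -> Prop) : nat := \sum_(u <- fset_set (below X)) rank (idl I) (h u).

(** Only finitely many values lie below X: induct on the number of those exceeding the value of
    x. *)
Lemma max_value (P : D -> Prop) : (exists x, P x) -> (forall x, P x -> x != 0 /\ w x%:F < X) ->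
  exists x, P x /\ forall y, P y -> w y%:F <= w x%:F.
Proof.
move=> [x0 Px0] hP; apply: contrapT => /forallNP nmax.
have big x : P x -> exists y, P y /\ w x%:F < w y%:F.
  move=> Px; have := nmax x; move=> /not_andP [//|/existsNP [y /not_implyP [Py /negP]]].
  by rewrite -ltNge => lt; exists y.
have inS x : P x -> below X (v x%:F).
  by move=> Px; have [x0' wx] := hP x Px; split=> //; exists x.
pose cnt x := ncard (below X `&` [set u | w x%:F < h u]).
suff : forall n x, P x -> (cnt x <= n)%N -> False by move=> /(_ _ _ Px0 (leqnn _)).
elim=> [|n IH] x Px hx; have [y [Py xy]] := big x Px.
  have : (ncard [set v y%:F] <= 0)%N.
    apply: leq_trans hx; apply: ncard_sub; first exact: finite_setIl.
    by move=> _ ->; split=> //; apply: inS.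
  by rewrite /ncard fset_set1 cardfs1.
apply: (IH y Py); rewrite -ltnS; apply: leq_trans hx.
rewrite /cnt [X in (_ < X)%N](@ncard_split _ [set u | w y%:F < h u]); last exact: finite_setIl.
rewrite -addn1; apply: leq_add.
  apply: ncard_sub; first by do 2 apply: finite_setIl.
  by move=> u [bu yu]; split=> //; split=> //; apply: lt_trans yu.
have one : ncard [set v y%:F] = 1%N by rewrite /ncard fset_set1 cardfs1.
apply: leq_trans (eq_leq (esym one)) _; apply: ncard_sub; first by do 2 apply: finite_setIl.
by move=> _ ->; split; [split=> //; apply: inS | rewrite /= ltxx].
Qed.

Lemma rank_sum_mono I J : isubset I J -> (rank_sum I <= rank_sum J)%N.
Proof.
move=> IJ; apply: leq_sum => u _; apply: rank_sub => x [r [Ir ->]].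
by exists r; split=> //; apply: IJ.
Qed.

Lemma rank_sum_le_top I : (rank_sum I <= rank_sum (fun=> True))%N.
Proof. exact: rank_sum_mono. Qed.

Definition deep (I : D -> Prop) := forall r, r != 0 -> X <= w r%:F -> I r.

Lemma max_outside I J : is_ideal I -> deep I -> strict_subset I J ->
  exists x, [/\ J x, ~ I x, below X (v x%:F) & forall y, J y -> ~ I y -> w y%:F <= w x%:F].
Proof.
move=> hI dI [_ [x0 [Jx0 nIx0]]].
have hP x : J x /\ ~ I x -> x != 0 /\ w x%:F < X.
  move=> [_ nIx]; have x_0 : x != 0 by apply/eqP => E; apply: nIx; rewrite E; apply: ideal0.
  by split=> //; rewrite ltNge; apply/negP => /dI; apply: contra_not nIx => /(_ x_0).
have [|x [[Jx nIx] mx]] := max_value _ hP; first by exists x0.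
exists x; split=> //; last by move=> y Jy nIy; apply: mx.
by have [x_0 wx] := hP x (conj Jx nIx); split=> //; exists x.
Qed.

Lemma rank_sum_strict I J : is_ideal I -> is_ideal J -> deep I -> strict_subset I J ->
  (rank_sum I < rank_sum J)%N.
Proof.
move=> hI hJ dI IJ; have [x [Jx nIx bx mx]] := max_outside hI dI IJ.
have lt := rank_grow hI hJ (proj1 IJ) Jx nIx mx.
have xin : v x%:F \in fset_set (below X) by rewrite in_fset_set // inE.
rewrite /rank_sum !(big_fsetD1 _ xin) /=.
rewrite -addSn; apply: leq_add => //.
apply: leq_sum => u _; apply: rank_sub => y [r [Ir ->]].
by exists r; split=> //; apply: (proj1 IJ).
Qed.

Lemma rank_sum_add_elt I x : is_ideal I -> ~ I x -> (forall y, ~ I y -> w y%:F <= w x%:F) ->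
  below X (v x%:F) -> (rank_sum (add_elt I x) <= (rank_sum I).+1)%N.
Proof.
move=> hI nIx mx bx.
have xin : v x%:F \in fset_set (below X) by rewrite in_fset_set // inE.
rewrite /rank_sum !(big_fsetD1 _ xin) /= -addSn; apply: leq_add.
  exact: rank_add_elt_eq.
rewrite big_seq [X in (_ <= X)%N]big_seq; apply: leq_sum => u; rewrite in_fsetD1 => /andP[ux _].
apply: rank_add_elt_neq => //; apply: contra ux => /eqP /(okv_inj ok) ->; exact: eqxx.
Qed.

(* Adding to I an element of maximal value outside I raises a single rank, by one, so a
   greedy chain attains the upper bound given by the ranks. *)
Lemma is_colength_rank_sum I : is_ideal I -> deep I ->
  is_colength I (rank_sum (fun=> True) - rank_sum I).
Proof.
move=> hI dI; split; last first.
  move=> K n [K0 [Kn [Kid Kst]]].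
  have dK i : (i <= n)%N -> deep (K i).
    elim: i => [|i IH] le r r0 wr; first by apply/K0; apply: dI.
    by apply: (proj1 (Kst _ le)); apply: IH => //; apply: ltnW.
  have hi i : (i <= n)%N -> (rank_sum I + i <= rank_sum (K i))%N.
    elim: i => [|i IH] le; first by rewrite addn0; apply: rank_sum_mono => x /K0.
    rewrite addnS; apply: leq_ltn_trans (IH (ltnW le)) _.
    by apply: rank_sum_strict; [apply: Kid; apply: ltnW | apply: Kid | apply: dK; apply: ltnW | apply: Kst].
  have := leq_trans (hi _ (leqnn n)) (rank_sum_le_top (K n)).
  by move: (rank_sum I) (rank_sum _) => a b; lia.
move E : (_ - _)%N => n.
have hT : is_ideal (fun _ : D => True) by [].
elim: n I hI dI E => [|n IH] I hI dI E.
  exists (fun=> I); split=> //; split; last by split.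
  move=> x; apply: contrapT => nIx.
  have : (rank_sum I < rank_sum (fun=> True))%N by apply: rank_sum_strict => //; split=> //; exists x.
  by move: E; move: (rank_sum I) (rank_sum _) => a b; lia.
have [x0 nIx0] : exists x, ~ I x.
  apply: contrapT => /forallNP all; have : (rank_sum (fun=> True) <= rank_sum I)%N.
    by apply: rank_sum_mono => x _; apply: contrapT (all x).
  by move: E; move: (rank_sum I) (rank_sum _) => a b; lia.
have [|x [_ nIx bx mx]] := @max_outside I (fun=> True) hI dI; first by split=> //; exists x0.
have {}mx y : ~ I y -> w y%:F <= w x%:F by move=> nIy; apply: mx.
have hJ := @add_elt_ideal I x hI; have IJ := @sub_add_elt I x.
have Jx := @mem_add_elt I x hI.
have st : strict_subset I (add_elt I x) by split=> //; exists x.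
have r1 := rank_sum_strict hI hJ dI st.
have r2 := rank_sum_add_elt hI nIx mx bx.
have [|||K [K0 [Kn [Kid Kst]]]] := IH (add_elt I x) => //.
- by move=> r r0 wr; apply: IJ; apply: dI.
- by move: E r1 r2; move: (rank_sum I) (rank_sum _) (rank_sum _) => a b c; lia.
exists (fun i => if i is i'.+1 then K i' else I); split=> //; split=> //; split.
  by case=> // i; apply: Kid.
case=> [_|i]; last exact: Kst.
split; first by move=> y /IJ /K0.
by exists x; split=> //; apply/K0.
Qed.

Lemma colengthE I : is_ideal I -> deep I ->
  colength I = (rank_sum (fun=> True) - rank_sum I)%N.
Proof.
move=> hI dI; rewrite /colength; case: ClassicalEpsilon.excluded_middle_informative => [ex|nex]; last first.
  by case: nex; eexists; apply: is_colength_rank_sum.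
case: ClassicalEpsilon.constructive_indefinite_description => n [[K hK] hn] /=.
have [[K' hK'] hn'] := is_colength_rank_sum hI dI.
by apply/eqP; rewrite eqn_leq (hn' _ _ hK) (hn _ _ hK').
Qed.

Lemma below_compl I : deep I -> S `&` ~` values I = below X `&` ~` values I.
Proof.
move=> dI; apply/seteqP; split=> u [Su nu]; split=> //; last by case: Su.
split=> //; rewrite ltNge; apply/negP => hu; apply: nu.
by have [r [_ r0 ru]] := Su; exists r; split=> //; apply: dI => //; rewrite ru.
Qed.

Lemma rank_sum_le I : (rank_sum I <= res_degree * ncard (below X `&` values I))%N.
Proof.
rewrite -sum_asbool // big_distrr /=; apply: leq_sum => u _.
case: asboolP => [_|nu]; first by rewrite muln1 rank_le_res.
by rewrite (rank_values (erefl (h u)) nu).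
Qed.

Lemma rank_sum_ge g I : g != 0 -> is_ideal I ->
  (forall u, values I u -> rank (idl I) (h u + w g%:F) = res_degree) ->
  (res_degree * ncard (below (X - w g%:F) `&` values I) <= rank_sum I)%N.
Proof.
move=> g0 hI hg; pose W : set L := [set u | values I (u - v g%:F)].
have fW : finite_set (below X `&` W) by exact: finite_setIl.
apply: (@leq_trans (res_degree * ncard (below X `&` W))%N).
  rewrite leq_mul2l; apply/orP; right.
  apply: (@ncard_inj _ (fun u => u + v g%:F)) => //.
  - exact: addIr.
  - exact: finite_setIl.
  move=> u [[_ hu] [r [Ir r0 ru]]]; split; last by rewrite /W /= addrK; exists r.
  split; last by rewrite raddfD; move: hu; rewrite ltrBrDr.
  exists (r * g); split=> //; first by rewrite mulf_neq0.
  by rewrite rmorphM (okvM ok) ?tofrac_eq0 // ru.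
rewrite -sum_asbool // big_distrr /=; apply: leq_sum => u _.
case: asboolP => [Wu|_]; last by rewrite muln0.
by rewrite muln1 -(hg _ Wu) raddfB subrK.
Qed.

(** The rank sums of I and of D are each trapped between [res_degree] times a count of values and
    the same count without the top slab of thickness [w g]; subtracting them leaves the slab as the
    only error. *)
Lemma colength_count g I : g != 0 -> is_ideal I -> deep I ->
  (forall J, is_ideal J -> forall u, values J u -> rank (idl J) (h u + w g%:F) = res_degree) ->
  let slab := (ncard (below X) - ncard (below (X - w g%:F)))%N in
  (colength I <= res_degree * (ncard (S `&` ~` values I) + slab))%N /\
  (res_degree * ncard (S `&` ~` values I) <= colength I + res_degree * slab)%N.
Proof.
move=> g0 hI dI hg slab.
have hT : is_ideal (fun _ : D => True) by [].
have wg : 0 <= w g%:F by apply: (okv_ge0 ok); rewrite tofrac_eq0.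
have sb : below (X - w g%:F) `<=` below X by apply: below_mono; rewrite gerBl.
have E1 := ncard_split (values I) (fin X).
have E2 := ncard_split (below (X - w g%:F)) (fin X).
rewrite (setIidr sb) in E2.
have h1 := rank_sum_le I; have h2 := rank_sum_le (fun=> True).
have h3 := rank_sum_ge g0 hI (hg _ hI); have h4 := rank_sum_ge g0 hT (hg _ hT).
have sS Y : below Y `&` S = below Y by apply: setIidl => u [].
rewrite !sS in h2 h4.
have h5 : (ncard (below X `&` values I) <=
    ncard (below (X - w g%:F) `&` values I) + slab)%N.
  rewrite (@ncard_split _ (below (X - w g%:F)) (below X `&` values I)); last exact: finite_setIl.
  apply: leq_add.
    by apply: ncard_sub; [exact: finite_setIl | move=> u [[_ Vu] bu]].
  rewrite /slab E2 addKn; apply: ncard_sub; first exact: finite_setIl.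
  by move=> u [[bu _] nu].
rewrite colengthE // below_compl //.
have h6 : (ncard (below (X - w g%:F)) <= ncard (below X))%N by exact: ncard_sub.
move: h1 h2 h3 h4 h5 h6 E1; rewrite {E2}/slab.
move: (ncard (below X `&` values I)) (ncard (below (X - _) `&` values I))
  (ncard (below X `&` ~` values I)) => a b c.
move: (rank_sum I) (rank_sum _) (ncard (below X)) (ncard (below (X - _))) res_degree.
move=> rI rT n n' B h1 h2 h3 h4 h5 h6 E1; split.
- have : (B * a <= B * (b + (n - n')))%N by rewrite leq_mul2l h5 orbT.
  by rewrite E1 in h2 *; rewrite !mulnDr in h2 *; lia.
- have : (B * n <= B * (n' + (n - n')))%N by rewrite leq_mul2l subnKC ?leqnn ?orbT.
  by rewrite E1 !mulnDr; lia.
Qed.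

End Colength.
End Valued.

(** * Cones and linear bounds *)

Lemma coord_le_norm (R : realType) n (x : 'rV[R]_n) i : `|x 0 i| <= `|x|.
Proof. by rewrite [leRHS]mx_normrE; exact: (le_bigmax _ (fun ij => `|x ij.1 ij.2|) (0, i)). Qed.

(** The unit sphere of the closed cone is compact, so its image under the positive functional is
    closed and misses 0, hence stays above some [e > 0]; homogeneity extends the bound to the
    cone. *)
Lemma cone_height_bound (R : realType) n (a : 'I_n -> R) (C : set 'rV[R]_n) :
  closed C -> (forall l x, 0 <= l -> C x -> C (l *: x)) ->
  (forall x, C x -> x != 0 -> 0 < \sum_i x 0 i * a i) ->
  exists2 k, 0 < k & forall x, C x -> forall i, `|x 0 i| <= k * \sum_i x 0 i * a i.
Proof.
move=> Ccl Csc Cpos.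
pose f (x : 'rV[R]_n) := \sum_i x 0 i * a i.
have fc : continuous f.
  apply: continuous_big; first exact: add_continuous.
  move=> i _ x; apply: continuousM; last exact: cst_continuous.
  exact: coord_continuous.
have fZ l x : f (l *: x) = l * f x.
  by rewrite /f mulr_sumr; apply: eq_bigr => i _; rewrite mxE mulrA.
pose K := C `&` [set x | `|x| = 1].
have Kc : compact K.
  apply: bounded_closed_compact.
    by exists 1; split; [exact: num_real | move=> M M1 x [_ /= ->]; apply: ltW].
  apply: closedI => //.
  have -> : [set x : 'rV[R]_n | `|x| = 1] = (fun x => `|x|) @^-1` [set 1] by [].
  apply: preimage_closed; last by apply: compact_closed; [exact: Rhausdorff | exact: compact_set1].
  by move=> x _; apply: norm_continuous.
have fKc : closed (f @` K).
  apply: compact_closed; first exact: Rhausdorff.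
  by apply: continuous_compact => //; apply: continuous_subspaceT.
have nK0 : ~ (f @` K) 0.
  move=> [x [Cx x1] fx0].
  have x0 : x != 0 by rewrite -normr_eq0 x1 oner_neq0.
  by have := Cpos x Cx x0; rewrite -/(f x) fx0 ltxx.
have [e e0 he] : exists2 e, 0 < e & forall x, K x -> e <= f x.
  have := @open_nbhs_nbhs _ (0 : R) (~` (f @` K)).
  rewrite /open_nbhs /=; move=> /(_ (conj (closed_openC fKc) nK0)).
  rewrite -nbhs_ballE => -[e /= e0 he]; exists e => // x Kx.
  rewrite leNgt; apply/negP => lt.
  have fx0 : 0 <= f x.
    have [Cx x1] := Kx; have x0 : x != 0 by rewrite -normr_eq0 x1 oner_neq0.
    by apply: ltW; apply: Cpos.
  apply: (he (f x)); last by exists x.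
  by rewrite /ball /= sub0r normrN ger0_norm.
exists e^-1; first by rewrite invr_gt0.
move=> x Cx i; have [->|x0] := eqVneq x 0.
  by rewrite mxE normr0 -/(f 0) -[X in f X](scale0r (0 : 'rV[R]_n)) fZ mul0r mulr0.
have nx : 0 < `|x| by rewrite normr_gt0.
have Kx : K (`|x|^-1 *: x).
  split; first by apply: Csc; rewrite ?invr_ge0.
  by rewrite /= normrZ normfV normr_id mulVf // normr_eq0.
have := he _ Kx; rewrite fZ mulrC ler_pdivlMr // => h1.
rewrite mulrC ler_pdivlMr //; apply: le_trans h1; rewrite mulrC ler_pM2l //.
exact: coord_le_norm.
Qed.

(** * Volumes of p-families *)

Lemma pigeonhole_count (T : eqType) (s t : seq T) k : {subset t <= s} ->
  (size s * k < size t)%N -> exists2 y, y \in s & (k <= count_mem y t)%N.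
Proof.
elim: s t => [|y s IH] t ts; first by case: t ts => // z t /(_ z); rewrite inE eqxx => /(_ isT).
rewrite /= mulSn => lt.
have [ky|ky] := leqP k (count_mem y t); first by exists y; rewrite ?inE ?eqxx.
have [||z zs kz] := IH [seq z <- t | z != y].
- by move=> z; rewrite mem_filter => /andP[zy /ts]; rewrite inE (negbTE zy).
- have -> : size [seq z <- t | z != y] = (size t - count_mem y t)%N.
    by rewrite size_filter -(count_predC (pred1 y) t) addKn.
  by move: (count _ _) lt ky => c; lia.
exists z; first by rewrite inE zs orbT.
by apply: leq_trans kz _; rewrite count_filter; apply: sub_count => x /andP[].
Qed.

Section IdealFamilies.
Variable A : comNzRingType.
Implicit Types (I J M : A -> Prop) (s t : seq A).

Lemma prod_idealM I J a b : I a -> J b -> prod_ideal I J (a * b).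
Proof. by move=> Ia Jb; apply: gen_ideal_sub; exists a, b. Qed.

Lemma p_family_pow p (I : nat -> A -> Prop) e x : p_family p I -> I e x -> I e.+1 (x ^+ p).
Proof. by move=> [_ hI] Ix; apply: hI; apply: gen_ideal_sub; exists x. Qed.

Lemma p_family_pown p (I : nat -> A -> Prop) e x : p_family p I -> I 0%N x -> I e (x ^+ (p ^ e)).
Proof.
move=> hI Ix; elim: e => [|e IH]; first by rewrite expn0 expr1.
by rewrite expnSr exprM; apply: p_family_pow.
Qed.

(** In characteristic p the elements whose p-th power lies in the next product ideal form an ideal,
    so it is enough to test the generators [a * b]. *)
Lemma p_family_prod p (I J : nat -> A -> Prop) : p \in [pchar A] ->
  p_family p I -> p_family p J -> p_family p (fun e => prod_ideal (I e) (J e)).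
Proof.
move=> pA hI hJ; split=> [e|e x]; first exact: gen_ideal_ideal.
have hL : is_ideal (prod_ideal (I e.+1) (J e.+1)) by exact: gen_ideal_ideal.
apply=> // _ [y [Ly ->]].
apply: (Ly (fun z => prod_ideal (I e.+1) (J e.+1) (z ^+ p))).
  split; first by rewrite -(pFrobenius_autE pA) rmorph0; apply: (ideal0 hL).
  split=> [u w Lu Lw|r u Lu]; last by rewrite exprMn; apply: (idealMl _ hL).
  by rewrite -!(pFrobenius_autE pA) rmorphD; apply: (idealD hL); rewrite ?pFrobenius_autE.
move=> _ [a [b [Ia [Jb ->]]]]; rewrite exprMn.
by apply: prod_idealM; apply: p_family_pow.
Qed.

Lemma prod_pow_count y t : \prod_(z <- t) z = y ^+ count_mem y t * \prod_(z <- t | z != y) z.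
Proof.
rewrite (bigID (pred1 y)) /=; congr (_ * _).
rewrite (eq_bigr (fun=> y)) => [|z /eqP //].
by rewrite big_const_seq iter_mulr_1.
Qed.

(** Generated ideals are used by testing them on colon ideals of J: first the b with [a * b] in J,
    then the a with [a * y] in J, which lowers the exponent by one. *)
Lemma ideal_pow_prods M s N J x : (forall x, M x -> gen_ideal (fun y => y \in s) x) ->
  is_ideal J -> (forall t, size t = N -> {subset t <= s} -> J (\prod_(z <- t) z)) ->
  ideal_pow M N x -> J x.
Proof.
move=> Ms; elim: N J x => [|N IH] J x hJ ht /=.
  by move=> _; rewrite -[x]mulr1; apply: idealMl => //; have := ht [::]; rewrite big_nil; apply.
apply=> // _ [a [b [Ma [/Ms Mb ->]]]].
apply: (Mb (fun b => J (a * b))).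
  split; first by rewrite mulr0; apply: ideal0.
  split=> [y z Jy Jz|r y Jy]; first by rewrite mulrDr; apply: idealD.
  by rewrite mulrCA; apply: idealMl.
move=> y ys; apply: (IH (fun a => J (a * y))) => //.
  split; first by rewrite mul0r; apply: ideal0.
  split=> [u z Ju Jz|r u Ju]; first by rewrite mulrDl; apply: idealD.
  by rewrite -mulrA; apply: idealMl.
move=> t szt ts; have := ht (y :: t); rewrite big_cons mulrC; apply; first by rewrite /= szt.
by move=> z; rewrite inE => /orP[/eqP -> //|/ts].
Qed.

(* A monomial of degree (|s|+1)k in the generators s is divisible by the k-th power of one. *)
Lemma ideal_pow_sub M s k I x : (forall x, M x -> gen_ideal (fun y => y \in s) x) ->
  is_ideal I -> (0 < k)%N -> (forall y, y \in s -> I (y ^+ k)) ->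
  ideal_pow M ((size s).+1 * k) x -> I x.
Proof.
move=> Ms hI k0 hs; apply: (ideal_pow_prods Ms) => // t szt ts.
have [|y ys ky] := @pigeonhole_count _ s t k ts; first by rewrite szt ltn_pmul2r.
rewrite (prod_pow_count y) -(subnKC ky) exprD -!mulrA.
by apply: idealMr => //; apply: hs.
Qed.

Lemma common_exponent I s : is_ideal I -> (forall y, y \in s -> exists n, I (y ^+ n)) ->
  exists2 k, (0 < k)%N & forall y, y \in s -> I (y ^+ k).
Proof.
move=> hI; elim: s => [|y s IH] hs; first by exists 1%N.
have [|k k0 hk] := IH; first by move=> z zs; apply: hs; rewrite inE zs orbT.
have [n hn] := hs y (mem_head _ _).
exists (n + k)%N; first by rewrite addn_gt0 k0 orbT.
move=> z; rewrite inE exprD => /orP[/eqP ->|zs]; first exact: idealMr.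
by apply: idealMl => //; apply: hk.
Qed.

End IdealFamilies.

Lemma lattice_growth (R : realType) d (h : {additive 'rV[int]_d -> R}) (S : set 'rV[int]_d) (k : R) :
  0 < k -> (forall u, S u -> forall i, `|(u 0 i)%:~R| <= k * h u) ->
  (forall X, finite_set (below h S X)) /\
  exists K, forall T, 1 <= T -> (ncard (below h S T))%:R <= K * T ^+ d.
Proof.
move=> k0 hk.
pose N (T : R) := (Num.truncn (k * T)).+1.
pose f n (b : {ffun 'I_d -> 'I_(n + n).+1}) : 'rV[int]_d := \row_i ((b i : nat)%:Z - n%:Z).
pose A T := [fset f (N T) b | b in {ffun 'I_d -> 'I_(N T + N T).+1}]%fset.
have sub T : below h S T `<=` [set` A T].
  move=> u [Su hu].
  have hN i : (`|(u 0 i)%R| <= N T)%N.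
    have : `|(u 0 i)%:~R| <= (N T)%:R :> R.
      apply: le_trans (hk u Su i) _; apply: le_trans (_ : k * T <= _).
        by rewrite ler_pM2l // ltW.
      exact: ltW (truncnS_gt _).
    by rewrite -intr_norm -[X in _ <= X]/((Posz (N T))%:~R) ler_int; lia.
  have hb i : (`|(u 0 i + (N T)%:Z)%R| < (N T + N T).+1)%N by have := hN i; lia.
  pose b : {ffun 'I_d -> 'I_(N T + N T).+1} := [ffun i => Ordinal (hb i)].
  rewrite /=; apply/imfsetP; exists b => //=; apply/rowP => i; rewrite mxE ffunE /=.
  by have := hN i; lia.
have fin T : finite_set (below h S T) by apply: sub_finite_set (sub T) _; exact: finite_fset.
(* Each side of the box has 2 N + 1 integers with N at most k T + 1, hence at most (2 k + 3) T of
   them as [1 <= T]. *)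
split=> //; exists ((2 * k + 3) ^+ d) => T T1.
apply: (@le_trans _ _ ((N T + N T).+1 ^ d)%:R).
  rewrite ler_nat; apply: leq_trans (ncard_sub _ (sub T)) _; first exact: finite_fset.
  rewrite /ncard set_fsetK; apply: leq_trans (leq_imfset_card _ _ _) _.
  by rewrite /= -cardE card_ffun !card_ord.
rewrite natrX -exprMn; apply: lerXn2r; rewrite ?nnegrE //; first by nra.
have h1 : (Num.truncn (k * T))%:R <= k * T by rewrite truncn_le // mulr_ge0 //; lra.
rewrite /N -addn1 !natrD -natr1; nra.
Qed.

Section Volumes.
Variables (D : idomainType) (R : realType) (d : nat).
Local Notation F := {fraction D}.
Local Notation L := 'rV[int]_d.
Local Notation "x %:F" := (@FracField.tofrac D x).
Variables (v : F -> L) (h : {additive L -> R}) (m : D -> Prop).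
Hypothesis ok : ok_valuation v h m.
Local Notation S := (values v (fun=> True)).
Local Notation w x := (h (v x)).

Lemma valueX x n : x != 0 -> v (x ^+ n) = v x *+ n.
Proof.
move=> x0; elim: n => [|n IH]; first by rewrite expr0 mulr0n (v1 ok).
by rewrite exprS mulrS (okvM ok) // ?expf_neq0 // IH.
Qed.

Lemma values_good (k : R) : 0 < k -> (forall u, exists2 x : F, x != 0 & v x = u) ->
  (forall u, S u -> forall i, `|(u 0 i)%:~R| <= k * h u) -> good_semigroup h S.
Proof.
move=> k0 vs hk; have [fin gr] := lattice_growth k0 hk.
split=> //.
- by exists 1; split; rewrite ?oner_neq0 ?rmorph1 ?(v1 ok).
- move=> _ _ [r [_ r0 <-]] [s [_ s0 <-]]; exists (r * s); split=> //; first by rewrite mulf_neq0.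
  by rewrite rmorphM (okvM ok) ?tofrac_eq0.
- move=> u; have [x x0 <-] := vs u; have [a [b [b0 E]]] := frac_repr x.
  have a0 : a != 0.
    by move: x0; rewrite E; apply: contra => /eqP ->; rewrite rmorph0 mul0r.
  exists (v a%:F), (v b%:F); split; [by exists a | by exists b |].
  have -> : a%:F = x * b%:F by rewrite E divfK // tofrac_eq0.
  by rewrite (okvM ok) ?tofrac_eq0 // addrK.
- by move=> _ [r [_ r0 <-]]; apply: (okv_ge0 ok); rewrite tofrac_eq0.
Qed.

Lemma values_family p (I : nat -> D -> Prop) c : p_family p I -> 0 < c ->
  (forall e, deep v h (c * p%:R ^+ e) (I e)) ->
  exponent_family h S p (fun e => values v (I e)) c.
Proof.
move=> hI c0 dI; split=> //.
- by move=> e _ [r [Ir r0 <-]]; exists r.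
- move=> e _ _ [r [Ir r0 <-]] [s [_ s0 <-]]; exists (r * s); split.
  + by apply: idealMr => //; apply: (proj1 hI).
  + by rewrite mulf_neq0.
  + by rewrite rmorphM (okvM ok) ?tofrac_eq0.
- move=> e _ [r [Ir r0 <-]]; exists (r ^+ p); split.
  + exact: p_family_pow.
  + by rewrite expf_neq0.
  + by rewrite rmorphXn valueX // tofrac_eq0.
- by move=> e _ [r [_ r0 <-]] hr; exists r; split=> //; apply: dI.
Qed.

Hypothesis gS : good_semigroup h S.
Variable p : nat.
Hypothesis p1 : (1 < p)%N.

(** [colength_count] at the cutoff [c * q], beyond which I_q contains everything, reduces the
    colength to [ncompl_cvg]. *)
Lemma colength_cvg (I : nat -> D -> Prop) c V : p_family p I -> 0 < c ->
  (forall e, deep v h (c * p%:R ^+ e) (I e)) ->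
  asym d (@Nexc R d S p (fun e => values v (I e))) V ->
  forall eps, 0 < eps -> exists e0, forall e, (e0 <= e)%N ->
    `|(colength (I e))%:R / (p%:R ^+ e) ^+ d - (res_degree ok)%:R * V| <= eps.
Proof.
move=> hI c0 dI hV eps eps0.
have fS := values_family hI c0 dI.
have [g g0 hg] := rank_full ok.
have [s s0 hs] := gsg_density gS.
set B := res_degree ok.
(* Count and slab cost [B * eta] each; the extra 1 keeps the divisor positive whatever [B]. *)
pose eta := eps / (2 * B%:R + 1).
have B0 : 0 < 2 * B%:R + 1 :> R by rewrite ltr_wpDl // mulr_ge0.
have eta0 : 0 < eta by rewrite divr_gt0.
have [T0 hT0] := asymB (asym_affine 0 c0 hs) (asym_affine (- w g%:F) c0 hs) eta0.
have [e1 he1] := exprp_unbounded p1 T0.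
have [e2 he2] := ncompl_cvg gS p1 fS hV eta0.
exists (maxn e1 e2) => e; rewrite geq_max => /andP[/he1 /hT0 h1 /he2 h2].
set q := p%:R ^+ e in h1 h2 *.
have qd : 0 < q ^+ d by rewrite exprn_gt0 //; apply: expr_pgt0.
have := colength_count (gsg_fin gS) g0 (proj1 hI e) (dI e) hg.
rewrite -/q -/B /= => -[h3 h4].
move: h1; rewrite subrr mul0r subr0 addr0 => h1.
set slab := (_ - _)%N in h3 h4.
have sb : (ncard (below h S (c * q - w g%:F)) <= ncard (below h S (c * q)))%N.
  apply: ncard_sub; first exact: (gsg_fin gS).
  by apply: below_mono; rewrite gerBl; apply: (okv_ge0 ok); rewrite tofrac_eq0.
have {h1} : slab%:R <= eta * q ^+ d.
  by rewrite /slab natrB //; apply: le_trans h1; apply: ler_norm.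
move: h2 h3 h4; rewrite /ncompl; move: (ncard _) (colength _) slab => nc co sl h2 h3 h4 h1.
have {}h3 : co%:R <= B%:R * (nc%:R + sl%:R) :> R by rewrite -natrD -natrM ler_nat.
have {}h4 : B%:R * nc%:R <= co%:R + B%:R * sl%:R :> R by rewrite -!natrM -natrD ler_nat.
have E : eps = (2 * B%:R + 1) * eta by rewrite /eta mulrC divfK // lt0r_neq0.
have -> : co%:R / q ^+ d - B%:R * V = (co%:R - B%:R * V * q ^+ d) / q ^+ d.
  by rewrite mulrBl mulfK ?lt0r_neq0.
rewrite normrM normfV (gtr0_norm qd) ler_pdivrMr //.
have h5 : B%:R * sl%:R <= B%:R * (eta * q ^+ d) by apply: ler_wpM2l.
have h6 : `|B%:R * (nc%:R - V * q ^+ d)| <= B%:R * (eta * q ^+ d).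
  by rewrite normrM ger0_norm //; apply: ler_wpM2l.
have h7 : 0 <= eta * q ^+ d by rewrite mulr_ge0 // ltW.
move: h6; rewrite !ler_norml E => /andP[h6 h8]; apply/andP; split; lra.
Qed.

Variables (v0 : R) (s : seq D).
Hypothesis hs : forall x, m x -> gen_ideal (fun y => y \in s) x.
Hypothesis hv0 : forall (n : nat) (r : D), r != 0 -> n%:R * v0 <= w r%:F -> ideal_pow m n r.

(** The powers [y ^+ (k * p ^ e)] of the generators of m lie in [I e], so a power of m with exponent
    linear in p^e does too; [hv0] converts height into such powers. The summand 1 in the constant
    makes it positive. *)
Lemma deep_family (I : nat -> D -> Prop) k : p_family p I -> (0 < k)%N ->
  (forall y, y \in s -> I 0%N (y ^+ k)) ->
  exists2 c, 0 < c & forall e, deep v h (c * p%:R ^+ e) (I e).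
Proof.
move=> hI k0 hk; exists (((size s).+1 * k)%:R * `|v0| + 1); first by rewrite ltr_wpDl // mulr_ge0.
move=> e r r0 hr.
have pe : (0 < p ^ e)%N by rewrite expn_gt0 ltnW.
apply: (@ideal_pow_sub _ m s (k * p ^ e)) => //; first exact: (proj1 hI).
- by rewrite muln_gt0 k0.
- by move=> y /hk Iy; rewrite exprM; apply: p_family_pown.
apply: hv0 => //; apply: le_trans hr.
rewrite mulnA natrM natrX mulrAC ler_pM2r ?expr_pgt0 //.
by apply: ler_wpDr => //; rewrite ler_wpM2l // ler_norm.
Qed.

Theorem volume_inequality (I J : nat -> D -> Prop) : (0 < d)%N -> p \in [pchar D] ->
  p_family p I -> p_family p J -> is_ideal m ->
  (forall y, y \in s -> m y) -> m_primary m (I 0%N) -> m_primary m (J 0%N) ->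
  exists vI vJ vL : R, [/\ 0 <= vI, 0 <= vJ & 0 <= vL] /\ [/\
   forall eps, 0 < eps -> exists e0, forall e, (e0 <= e)%N ->
    `|(colength (I e))%:R / (p%:R ^+ e) ^+ d - vI| <= eps,
   forall eps, 0 < eps -> exists e0, forall e, (e0 <= e)%N ->
    `|(colength (J e))%:R / (p%:R ^+ e) ^+ d - vJ| <= eps,
   forall eps, 0 < eps -> exists e0, forall e, (e0 <= e)%N ->
    `|(colength (prod_ideal (I e) (J e)))%:R / (p%:R ^+ e) ^+ d - vL| <= eps &
   forall l n : R, 0 < l -> 0 < n -> l + n = 1 ->
     vL <= l / l ^+ d * vI + n / n ^+ d * vJ ].
Proof.
move=> d0 pD hI hJ hm sm [_ pI] [_ pJ].
have hL := p_family_prod pD hI hJ.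
have [kI kI0 hkI] : exists2 k, (0 < k)%N & forall y, y \in s -> I 0%N (y ^+ k).
  by apply: common_exponent => [|y /sm /pI]; first exact: (proj1 hI).
have [kJ kJ0 hkJ] : exists2 k, (0 < k)%N & forall y, y \in s -> J 0%N (y ^+ k).
  by apply: common_exponent => [|y /sm /pJ]; first exact: (proj1 hJ).
have [cI cI0 dI] := deep_family hI kI0 hkI.
have [cJ cJ0 dJ] := deep_family hJ kJ0 hkJ.
have [||cL cL0 dL] := @deep_family _ (kI + kJ) hL.
- by rewrite addn_gt0 kI0.
- by move=> y ys; rewrite exprD; apply: prod_idealM; [apply: hkI | apply: hkJ].
have fI := values_family hI cI0 dI; have fJ := values_family hJ cJ0 dJ.
have fL := values_family hL cL0 dL.
have [VI VI0 aI] := Nexc_asym gS p1 fI; have [VJ VJ0 aJ] := Nexc_asym gS p1 fJ.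
have [VL VL0 aL] := Nexc_asym gS p1 fL.
exists ((res_degree ok)%:R * VI), ((res_degree ok)%:R * VJ), ((res_degree ok)%:R * VL).
split; first by split; apply: mulr_ge0.
split.
- exact: (colength_cvg hI cI0 dI aI).
- exact: (colength_cvg hJ cJ0 dJ aJ).
- exact: (colength_cvg hL cL0 dL aL).
move=> l n l0 n0 ln.
rewrite [l / _ * _]mulrCA [n / _ * _]mulrCA -mulrDr; apply: ler_wpM2l => //.
apply: (volume_le gS p1 fI fJ fL _ aI aJ aL) => //.
move=> e _ _ [r [Ir r0 <-]] [t [Jt t0 <-]]; exists (r * t); split; first exact: prod_idealM.
  by rewrite mulf_neq0.
by rewrite rmorphM (okvM ok) ?tofrac_eq0.
Qed.

End Volumes.

(** * Real heights *)

Lemma IZR_intr z : IZR z = (int_of_Z z)%:~R :> R.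
Proof.
have pos n : IZR (Zpos n) = (Pos.to_nat n)%:R by rewrite IZRposE INRE -Pos_to_natE.
case: z => [//|n|n] /=; first exact: pos.
rewrite NegzE prednK ?mulrNz; last by apply/ssrnat.ltP; exact: Pos2Nat.is_pos.
by rewrite -[LHS]/(- IZR (Zpos n)) pos.
Qed.

Definition height d (a : 'I_d -> R) (u : 'rV[int]_d) : R := \sum_i (u 0 i)%:~R * a i.

Lemma height_is_additive d (a : 'I_d -> R) : zmod_morphism (height a).
Proof.
move=> u w; rewrite /height -sumrB; apply: eq_bigr => i _.
by rewrite !mxE rmorphB mulrBl.
Qed.

HB.instance Definition _ d (a : 'I_d -> R) :=
  GRing.isZmodMorphism.Build 'rV[int]_d R (height a) (height_is_additive a).

Definition zrow d (u : zvec d) : 'rV[int]_d := \row_i int_of_Z (u i).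

Lemma zdotE d (a : 'I_d -> R) (u : zvec d) : zdot u a = height a (zrow u).
Proof. by apply: eq_bigr => i _; rewrite mxE -IZR_intr. Qed.

(** Equal heights turn the difference vector into a rational relation between the coordinates of
    [a]. *)
Lemma height_inj d (a : 'I_d -> R) : Q_lin_indep a -> injective (height a).
Proof.
move=> ha u w E.
have E0 : height a (u - w) = 0 by rewrite height_is_additive E subrr.
apply/rowP => i; apply/eqP; rewrite -subr_eq0.
have := ha (fun i => QArith_base.inject_Z (Z_of_int ((u - w) 0 i))).
have Q2 z : Q2R (QArith_base.inject_Z z) = IZR z.
  by rewrite /Q2R /= Rinv_1 Rmult_1_r.
move=> /(_ _ i) H.
have {H} : QArith_base.Qeq (QArith_base.inject_Z (Z_of_int ((u - w) 0 i))) (QArith_base.inject_Z 0).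
  apply: H; rewrite -[RHS]E0; apply: eq_bigr => j _.
  by rewrite Q2 IZR_intr Z_of_intK.
rewrite /QArith_base.Qeq /= !mxE BinInt.Z.mul_1_r => /(congr1 int_of_Z).
by rewrite Z_of_intK => ->.
Qed.

Section RRoot.
Variable d : nat.
Hypothesis d0 : (0 < d)%N.

Lemma rroot_ge0 x : 0 <= rroot d x.
Proof.
rewrite /rroot; case: (Rle_dec x R0) => h; first exact: lexx.
by apply/RleP; apply: Rlt_le; apply: exp_pos.
Qed.

Lemma rroot_pow x : 0 <= x -> rroot d x ^+ d = x.
Proof.
move=> /RleP x0; rewrite /rroot; case: (Rle_dec x R0) => x1.
  by rewrite expr0n gtn_eqF //; apply: Rle_antisym.
have x2 : Rlt 0 x by exact: Rnot_le_lt.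
rewrite -RpowE -Rpower_pow; last exact: exp_pos.
rewrite Rpower_mult Rinv_l ?Rpower_1 //.
by apply: not_0_INR; apply/eqP; rewrite -lt0n.
Qed.

(** With a and b the roots of x and y, the bound is best at l = a / (a + b), where it reads z <= (a
    + b)^d. *)
Lemma rroot_le (x y z : R) : 0 <= x -> 0 <= y -> 0 <= z ->
  (forall l n : R, 0 < l -> 0 < n -> l + n = 1 -> z <= l / l ^+ d * x + n / n ^+ d * y) ->
  rroot d z <= rroot d x + rroot d y.
Proof.
move=> x0 y0 z0 H; apply/ler_addgt0Pr => e e0.
have := rroot_ge0 x; have := rroot_ge0 y; have := rroot_ge0 z.
have := rroot_pow x0; have := rroot_pow y0; have := rroot_pow z0.
move: (rroot d x) (rroot d y) (rroot d z) => a b c Ec Eb Ea c0 b0 a0.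
(* The roots may vanish while l and n must be positive, hence the [e / 2]. *)
pose a' := a + e / 2; pose b' := b + e / 2; pose t := a' + b'.
have a'0 : 0 < a' by rewrite /a'; lra.
have b'0 : 0 < b' by rewrite /b'; lra.
have t0 : 0 < t by rewrite /t; lra.
have := H (a' / t) (b' / t) (divr_gt0 a'0 t0) (divr_gt0 b'0 t0).
rewrite -mulrDl divff ?lt0r_neq0 // => /(_ erefl) hz.
have key u u' : 0 < u' -> 0 <= u <= u' -> u' / t / (u' / t) ^+ d * u ^+ d <= u' / t * t ^+ d.
  move=> u'0 /andP[u0 uu]; rewrite -mulrA ler_pM2l ?divr_gt0 //.
  rewrite expr_div_n invf_div mulrAC ler_pdivrMr ?exprn_gt0 //.
  by rewrite ler_pM2l ?exprn_gt0 // lerXn2r ?nnegrE // ltW.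
have ha : a' / t / (a' / t) ^+ d * x <= a' / t * t ^+ d.
  by rewrite -Ea; apply: key => //; rewrite a0 /a'; lra.
have hb : b' / t / (b' / t) ^+ d * y <= b' / t * t ^+ d.
  by rewrite -Eb; apply: key => //; rewrite b0 /b'; lra.
have : z <= t ^+ d.
  apply: le_trans hz _; apply: le_trans (lerD ha hb) _.
  by rewrite -!mulrDl divff ?lt0r_neq0 // mul1r.
have -> : a + b + e = t by rewrite /t /a' /b'; lra.
by rewrite -Ec (ler_pXn2r d0) ?nnegrE // ltW.
Qed.

End RRoot.

(** * Translation of the given valuation into heights of integer row vectors *)

Section Transfer.
Variables (D : idomainType) (m : D -> Prop) (d : nat) (a : 'I_d -> R).
Variable nu : {fraction D} -> zvec d.
Local Notation "x %:F" := (@FracField.tofrac D x).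
Local Notation v := (fun x => zrow (nu x)).

Lemma zrow_zero : zrow (@zzero d) = 0.
Proof. by apply/rowP => i; rewrite !mxE. Qed.

Lemma zdot_zero : zdot (@zzero d) a = 0.
Proof. by rewrite zdotE zrow_zero /height big1 // => i _; rewrite mxE mul0r. Qed.

Lemma val_ringP x : val_ring a nu x <-> val_ge v (height a) 0 x.
Proof.
rewrite /val_ring /F_ge /zle zdot_zero zdotE /val_ge; split.
  by move=> [->|[_ /RleP]] //; rewrite eqxx.
by have [->|x0] := eqVneq x 0; [left | right; split=> //; apply/RleP; exact: H].
Qed.

Lemma val_maxP x : val_max a nu x <-> val_gt v (height a) 0 x.
Proof.
rewrite /val_max /zlt zdot_zero zdotE /val_gt; split.
  by move=> [->|[_ /RltP]] //; rewrite eqxx.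
by have [->|x0] := eqVneq x 0; [left | right; split=> //; apply/RltP; exact: H].
Qed.

Lemma zrow_eq (u w : zvec d) : (forall i, u i = w i) -> zrow u = zrow w.
Proof. by move=> uw; apply/rowP => i; rewrite !mxE uw. Qed.

Lemma zrow_add (u w : zvec d) : zrow (zadd u w) = zrow u + zrow w.
Proof. by apply/rowP => i; rewrite !mxE /zadd -rmorphD. Qed.

Lemma zrow_surj (u : 'rV[int]_d) : exists w : zvec d, zrow w = u.
Proof. by exists (fun i => Z_of_int (u 0 i)); apply/rowP => i; rewrite mxE Z_of_intK. Qed.

Lemma zdot_scale n (u : zvec d) : zdot (zscale n u) a = n%:R * zdot u a.
Proof.
rewrite /zdot (big_morph _ (mulrDr n%:R) (mulr0 n%:R)); apply: eq_bigr => i _.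
by rewrite /zscale mult_IZR -INR_IZR_INZ INRE mulrA.
Qed.

Lemma ok_valuation_of : Q_lin_indep a -> is_valuation a nu -> OK_relative a nu m ->
  is_maximal_ideal m -> ok_valuation v (height a) m.
Proof.
move=> ha [nuM [_ nuD]] [H1 [H2 [_ [[s [s0 hs]] _]]]] hm; split=> //.
- exact: height_inj.
- by move=> x y x0 y0; rewrite -zrow_add; apply: zrow_eq; apply: nuM.
- move=> x y x0 y0 xy0; have [] := nuD x y x0 y0 xy0; rewrite /zle !zdotE => /RleP; by [left | right].
- by move=> r; apply/val_ringP.
- by move=> r; split=> [/H2 /val_maxP|/val_maxP /H2].
- exists s; split=> [x /s0 /val_ringP //|x /val_ringP /hs [c [szc hc]]].
  by exists c; split=> //; apply/val_maxP.
Qed.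

Definition closed_cone : set 'rV[(R : realType)]_d := [set x | in_closed_cone nu (fun i => x 0 i)].

Lemma closed_cone_closed : closed closed_cone.
Proof.
move=> x; rewrite closureEnbhs => hx eps /RltP eps0.
have e2 : 0 < eps / 2 by rewrite divr_gt0.
have [y [hy xy]] := hx closed_cone (ball x (eps / 2)) (fun _ h => h) (nbhsx_ballx x _ e2).
have [|w' [cw hw]] := hy (eps / 2); first exact/RltP.
exists w'; split=> // i; apply/RltP; rewrite RabsE RminusE.
have := hw i; move/RltP; rewrite RabsE RminusE => h1.
have h2 : `|x 0 i - y 0 i| < eps / 2.
  move: xy; rewrite -ball_normE /=; apply: le_lt_trans.
  by have := coord_le_norm (x - y) i; rewrite !mxE.
rewrite -(subrK (y 0 i) (x 0 i)) -addrA; apply: le_lt_trans (ler_normD _ _) _; lra.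
Qed.

Lemma closed_cone_scale l x : 0 <= l -> closed_cone x -> closed_cone (l *: x).
Proof.
rewrite le_eqVlt => /orP[/eqP <- _|l0 Cx] eps eps0.
  exists (fun=> 0); split; first by exists [::].
  by move=> i; rewrite mxE mul0r Rminus_diag Rabs_R0.
have [|w [[s [s0 hs]] hw]] := Cx (eps / l).
  by apply/RltP; rewrite divr_gt0 //; apply/RltP.
exists (fun i => l * w i); split; last first.
  move=> i; have := hw i => /RltP; rewrite RabsE RminusE => h1.
  apply/RltP; rewrite RabsE RminusE mxE -mulrBr normrM gtr0_norm // mulrC.
  by rewrite -ltr_pdivlMr.
exists [seq (l * pr.1, pr.2) | pr <- s]; split.
  move=> pr /List.in_map_iff [pr' [<- /s0 [h1 h2]]]; split=> //=.
  by apply/RleP; apply: mulr_ge0; [exact: ltW | apply/RleP].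
move=> i; rewrite hs; elim: s {s0 hs} => [|pr s IH] /=; first by rewrite mulr0.
by rewrite -IH mulrDr mulrA.
Qed.

Lemma value_closed_cone r : r != 0 -> closed_cone (\row_i IZR (nu r%:F i)).
Proof.
move=> r0 eps eps0; exists (fun i => IZR (nu r%:F i)); split; last first.
  by move=> i; rewrite mxE Rminus_diag Rabs_R0.
exists [:: (1, r)]; split=> [pr /= [<- /=|//]|i /=]; first by split=> //; apply/RleP.
by rewrite Rmult_1_l Rplus_0_r.
Qed.

(** Condition (ii) says that the height is positive on nonzero vectors of the closed cone, as
    [cone_height_bound] requires. *)
Lemma values_height_bound : OK_relative a nu m ->
  exists2 k, 0 < k & forall u, values v (fun=> True) u -> forall i, `|(u 0 i)%:~R| <= k * height a u.
Proof.
move=> [_ [_ [H3 _]]].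
have [|k k0 hk] := cone_height_bound closed_cone_closed closed_cone_scale (a := a).
  move=> x Cx x0; rewrite ltNge; apply/negP => le; case: (H3 _ Cx); split; last exact/RleP.
  apply: contrapT => nx; case/negP: x0; apply/eqP/rowP => i; rewrite mxE.
  by apply: contrapT => xi; apply: nx; exists i.
exists k => // _ [r [_ r0 <-]] i.
have E j : (zrow (nu r%:F) 0 j)%:~R = (\row_i IZR (nu r%:F i) : 'rV[R]_d) 0 j.
  by rewrite !mxE -IZR_intr.
rewrite E; apply: le_trans (hk _ (value_closed_cone r0) i) _.
by rewrite ler_pM2l // /height; rewrite le_eqVlt; apply/orP; left; apply/eqP; apply: eq_bigr => j _; rewrite E.
Qed.

End Transfer.

Theorem mainTheorem4 (D : idomainType) (m : D -> Prop) (d p : nat)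
    (I J : nat -> D -> Prop) :
  noetherian D -> local_with m -> krull_dim D d -> (0 < d)%N ->
  prime p -> (p \in [pchar D])%R -> OK_domain d m ->
  p_family p I -> p_family p J ->
  (forall e, m_primary m (I e)) -> (forall e, m_primary m (J e)) ->
  p_family p (fun e => prod_ideal (I e) (J e)) /\
  exists vI vJ vL : R,
    Un_cv (vol_seq p d I) vI /\ Un_cv (vol_seq p d J) vJ /\
    Un_cv (vol_seq p d (fun e => prod_ideal (I e) (J e))) vL /\
    Rle (rroot d vL) (Rplus (rroot d vI) (rroot d vJ)).
Proof.
move=> noeth [maxm _] _ d0 prp pD [a [nu [ha [hnu hok]]]] hI hJ pI pJ.
split; first exact: p_family_prod.
have ok := ok_valuation_of ha hnu hok maxm.
have [k k0 hk] := values_height_bound hok.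
have vs u : exists2 x : {fraction D}, x != 0 & zrow (nu x) = u.
  have [w <-] := zrow_surj u; have [x [x0 hx]] := hnu.2.1 w.
  by exists x => //; apply: zrow_eq.
have gS := values_good ok k0 vs hk.
have [s hs] := noeth m maxm.1.
have [v0 hv0] := hok.2.2.2.2.
have hv n (r : D) : r != 0 -> n%:R * zdot v0 a <= height a (zrow (nu (FracField.tofrac r))) ->
    ideal_pow m n r.
  move=> r0 hr; apply: hv0; right; split; first by rewrite tofrac_eq0.
  by rewrite /zle zdot_scale [zdot (nu _) a]zdotE; apply/RleP.
have hs1 x : m x -> gen_ideal (fun y => y \in s) x by move/hs.
have hs2 y : y \in s -> m y by move=> ys; apply/hs; exact: gen_ideal_sub.
have [vI [vJ [vL [[vI0 vJ0 vL0] [cI cJ cL ineq]]]]] :=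
  volume_inequality ok gS (prime_gt1 prp) hs1 hv d0 pD hI hJ maxm.1 hs2 (pI 0%N) (pJ 0%N).
have cv K l : (forall eps, 0 < eps -> exists e0, forall e, (e0 <= e)%N ->
    `|(colength (K e))%:R / (p%:R ^+ e) ^+ d - l| <= eps) -> Un_cv (vol_seq p d K) l.
  (* [Un_cv] asks for a strict inequality, hence [eps / 2]. *)
  move=> H eps /RltP eps0; have [|e0 he0] := H (eps / 2); first by rewrite divr_gt0.
  exists e0 => e /ssrnat.leP /he0 h1; apply/RltP.
  rewrite RdistE /vol_seq RdivE !INRE RpowE natrX; apply: le_lt_trans h1 _; by rewrite ltr_pdivrMr // ltr_pMr // ltr1n.
exists vI, vJ, vL; split; first exact: cv; split; first exact: cv; split; first exact: cv.
by apply/RleP; apply: rroot_le.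
Qed.
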